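(* Let $n\ge 1$, $k\ge 2$ be integers. Assume the following. 1. Observations $x_t\in\mathbb{R}^n$ and an auxiliary variable $u_t$ are obtained from a nonlinear vector autoregressive (NVAR) model $x_t=f(x_{t-1},s_t)$, $f:\mathbb{R}^{2n}\to\mathbb{R}^n$, with latent innovations $s_t=(s_1(t),\dots,s_n(t))^T\in\mathbb{R}^n$, whose augmented model $\tilde f:\mathbb{R}^{2n}\to\mathbb{R}^{2n}$, $\tilde f(s_t,x_{t-1})=(f(x_{t-1},s_t),\,x_{t-1})$, is invertible and sufficiently smooth. 2. The innovations are temporally independent and follow the conditional exponential family model of order $k$ given $u$ (with minimal $k$; see context) $$p(s\mid u)=\prod_{i=1}^n\frac{Q_i(s_i)}{Z_i(u)}\exp\Big[\sum_{j=1}^k q_{ij}(s_i)\lambda_{ij}(u)\Big],$$ where the sufficient statistics $q_{ij}$ are twice differentiable. 3. The auxiliary variable $u$ is an integer in $[1,T]$, where $T$ is the number of values it takes (classes). 4. The modulation matrix of size $nk\times(T-1)$ $$L=\big(\lambda(2)-\lambda(1),\dots,\lambda(T)-\lambda(1)\big)$$ has full row rank $nk$, where $\lambda(\tau)=(\lambda_{11}(u=\tau),\dots,\lambda_{nk}(u=\tau))^T\in\mathbb{R}^{nk}$. 5. A multinomial logistic regression with universal approximation capability is trained to predict the class label $u_t$ from $(x_t,x_{t-1})$, with the posterior modelled as $$p(u_t=\tau\mid x_t,x_{t-1})=\frac{\exp\big(\sum_{i=1}^n\sum_{j=1}^k z_{ij\tau}\big)}{\sum_{l=1}^T\exp\big(\sum_{i=1}^n\sum_{j=1}^k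 z_{ijl}\big)},\qquad z_{ijl}=w_{ijl}\,\psi_{ij}(h_i(x_t,x_{t-1}))+\phi(x_{t-1},u_t=l)+b_l,$$ where $w_{ijl},b_l$ are class-specific weight and bias parameters and $\psi_{ij},h_i,\phi$ are scalar-valued functions; write $h=(h_1,\dots,h_n)$. 6. The augmented function $\tilde h:\mathbb{R}^{2n}\to\mathbb{R}^{2n}$, $\tilde h(x_t,x_{t-1})=(h(x_t,x_{t-1}),x_{t-1})$, is invertible. 7. The functions $\psi_{ij}$ are twice differentiable, and for each $i$ the following implication holds: if $\theta\in\mathbb{R}^k$ is such that $\sum_{j=1}^k\psi_{ij}(y)\theta_j$ is constant in $y$, then $\theta=0$. Then, in the limit of infinite data in each class, $h$ provides a consistent estimator of the innovations: the functions $h_i(x_t,x_{t-1})$ give the independent innovations up to permutation and scalar (component-wise) invertible transformations, i.e. there are a permutation $\sigma$ of $\{1,\dots,n\}$ and invertible scalar functions $c_1,\dots,c_n$ such that $h_i(x_t,x_{t-1})=c_i(s_{\sigma(i)}(t))$ for all $i$, where $(s_t,x_{t-1})=\tilde f^{-1}(x_t,x_{t-1})$.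
   Context: Conditional exponential family model: each $s_i$ is statistically dependent on the auxiliary variable $u$, but, conditionally on $u$, independent of the other $s_j$, with univariate exponential family density as displayed in the claim; $Q_i$ is the base measure, $Z_i(u)$ the normalizing constant, $k$ the model order, $q_{ij}$ the sufficient statistics, and $\lambda_{ij}(u)$ scalar parameter functions of $u$. The order $k$ is minimal (the density cannot be rewritten in this form with a smaller $k'<k$), and for each $i$: if $(\lambda_{i1}(u),\dots,\lambda_{ik}(u))$ is such that $\sum_{j=1}^k q_{ij}(s_i)\lambda_{ij}(u)$ is constant in $s_i$, then $(\lambda_{i1}(u),\dots,\lambda_{ik}(u))=0$ (the distribution is ''strongly exponential''). Temporal independence: the innovations at different time points are independent, so that in particular, conditionally on $u_t$, the innovation $s_t$ is independent of $x_{t-1}$. Limit of infinite data in each class with universal approximation capability: the trained softmax model in hypothesis 5 equals the true posterior distribution of $u_t$ given $(x_t,x_{t-1})$ for all $\tau\in\{1,\dots,T\}$ and all $(x_t,x_{t-1})$.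
   Formalization: h is additionally assumed continuous; ''constant in s_i'' in the strongly exponential condition is read as constant on some nondegenerate interval; the law of (x_t,x_{t-1}) is assumed to charge every nonempty open set; the claim is false without these. *)

(* Defs.v *)
From HB Require Import structures.
From mathcomp Require Import all_boot all_order all_algebra perm.
From mathcomp Require Import all_classical all_reals all_analysis.

Set Implicit Arguments.
Unset Strict Implicit.
Unset Printing Implicit Defensive.

Import Order.TTheory GRing.Theory Num.Theory.
Import numFieldNormedType.Exports.

Local Open Scope classical_set_scope.
Local Open Scope ring_scope.

(* The library puts no sigma-algebra on row vectors.  [borelType V] is [V]
   itself, equipped with the sigma-algebra generated by its open sets. *)
Definition borelType (V : ptopologicalType) :=
  g_sigma_algebraType [set U : set V | open U].

Section Regularity.
Context {R : realType}.

Definition twice_derivable (g : R -> R) :=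
  (forall v : R, derivable g v 1) /\ (forall v : R, derivable (derive1 g) v 1).

Definition C1 (V W : normedModType R) (F : V -> W) :=
  (forall p, differentiable F p) /\
  (forall v, continuous (fun p => 'D_v F p)).

End Regularity.

Section Augmentation.
Context {R : realType} {n : nat}.
Local Notation vec := 'rV[R]_n.

Definition aug_model (f : vec -> vec -> vec) (p : vec * vec) : vec * vec :=
  (f p.2 p.1, p.2).

Definition aug_feature (h : vec -> vec -> vec) (p : vec * vec) : vec * vec :=
  (h p.1 p.2, p.2).

End Augmentation.

(* Class labels are the natural numbers [1, ..., T]; functions of the label are
   functions on [nat] whose values outside that range are irrelevant. *)
Section ExponentialFamily.
Context {R : realType}.

Definition expfam_weight (k : nat) (Q : R -> R) (q : 'I_k -> R -> R)
    (lam : 'I_k -> nat -> R) (tau : nat) (v : R) : R :=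
  Q v * expR (\sum_(j < k) q j v * lam j tau).

Definition expfam_density (k : nat) (Q : R -> R) (Z : nat -> R)
    (q : 'I_k -> R -> R) (lam : 'I_k -> nat -> R) (tau : nat) (v : R) : R :=
  Q v / Z tau * expR (\sum_(j < k) q j v * lam j tau).

Definition normalizing_constant (T k : nat) (Q : R -> R) (Z : nat -> R)
    (q : 'I_k -> R -> R) (lam : 'I_k -> nat -> R) :=
  forall tau : nat, (1 <= tau <= T)%N ->
    0 < Z tau /\
    (\int[lebesgue_measure]_v (expfam_weight Q q lam tau v)%:E)%E = (Z tau)%:E.

Definition has_expfam_form (T k : nat) (p : nat -> R -> R) :=
  exists (Q : R -> R) (Z : nat -> R) (q : 'I_k -> R -> R)
         (lam : 'I_k -> nat -> R),
    [/\ forall v, 0 <= Q v,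
        forall tau : nat, (1 <= tau <= T)%N -> 0 < Z tau
      & forall tau : nat, (1 <= tau <= T)%N ->
          forall v, p tau v = expfam_density Q Z q lam tau v].

Definition minimal_order (T k : nat) (p : nat -> R -> R) :=
  forall k' : nat, (k' < k)%N -> ~ has_expfam_form T k' p.

(* A combination of the sufficient statistics that is constant on a
   nondegenerate interval has zero parameters.  As usual for strongly
   exponential families the requirement is local: asking only about
   combinations constant on the whole line would allow all statistics to be
   constant on a common interval, on which the innovations would not be
   modulated by the auxiliary variable at all. *)
Definition strongly_exponential (T k : nat) (q : 'I_k -> R -> R)
    (lam : 'I_k -> nat -> R) :=
  forall tau : nat, (1 <= tau <= T)%N ->
    (exists a b c : R, a < b /\
       forall v, a < v < b -> \sum_(j < k) q j v * lam j tau = c) ->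
    forall j, lam j tau = 0.

Definition lambda_vec (n k : nat) (lam : 'I_n -> 'I_k -> nat -> R)
    (tau : nat) : 'cV[R]_(n * k) :=
  (mxvec (\matrix_(i < n, j < k) lam i j tau))^T.

Definition modulation_matrix (T n k : nat) (lam : 'I_n -> 'I_k -> nat -> R) :
    'M[R]_(n * k, T.-1) :=
  \matrix_(r < (n * k)%N, c < T.-1) (lambda_vec lam c.+2 - lambda_vec lam 1) r 0.

End ExponentialFamily.

Section Probability.
Context {R : realType} {d : measure_display} {Omega : measurableType d}.
Variable P : probability Omega R.
Local Open Scope ereal_scope.

(* Given [U = tau], the coordinates of [S] are independent and the [i]-th one
   has density [p i tau], i.e. [S] has density
   [s |-> \prod_i p i tau (s 0 i)]. *)
Definition cond_product_density (T n : nat) (U : {RV P >-> nat})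
    (S : {RV P >-> borelType 'rV[R]_n}) (p : 'I_n -> nat -> R -> R) :=
  forall tau : nat, (1 <= tau <= T)%N ->
  forall A : 'I_n -> set R, (forall i, measurable (A i)) ->
    P [set w | U w = tau /\ forall i, A i ((S w : 'rV[R]_n) ord0 i)] =
    P [set w | U w = tau] *
      \prod_(i < n) \int[lebesgue_measure]_(v in A i) (p i tau v)%:E.

Definition mutually_independent (d' : measure_display) (V : measurableType d')
    (S : nat -> {RV P >-> V}) :=
  forall (r : seq nat) (A : nat -> set V), uniq r ->
    (forall t, measurable (A t)) ->
    P [set w | forall t, t \in r -> A t (S t w)] =
    \prod_(t <- r) P (S t @^-1` A t).

(* Conditional independence of [X] and [Y] given the discrete variable [U],
   with the conditional probabilities multiplied out. *)
Definition cond_independent (d1 d2 : measure_display)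
    (V1 : measurableType d1) (V2 : measurableType d2)
    (U : {RV P >-> nat}) (X : {RV P >-> V1}) (Y : {RV P >-> V2}) :=
  forall (tau : nat) (A : set V1) (B : set V2), measurable A -> measurable B ->
    P [set w | [/\ U w = tau, A (X w) & B (Y w)]] * P [set w | U w = tau] =
    P [set w | U w = tau /\ A (X w)] * P [set w | U w = tau /\ B (Y w)].

(* [post tau] is a version of the conditional probability of [U = tau]
   given [X]. *)
Definition is_posterior (T : nat) (d' : measure_display)
    (V : measurableType d') (U : {RV P >-> nat}) (X : Omega -> V)
    (post : nat -> V -> R) :=
  forall tau : nat, (1 <= tau <= T)%N ->
    measurable_fun setT (post tau) /\
    forall B : set V, measurable B ->
      P [set w | U w = tau /\ B (X w)] =
      \int[P]_(w in X @^-1` B) (post tau (X w))%:E.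

(* Every open set is charged, so that conditional probabilities given [X] are
   meaningful around every point of [V]. *)
Definition full_support (V : topologicalType) (X : Omega -> V) :=
  forall O : set V, open O -> O !=set0 -> 0 < P (X @^-1` O).

End Probability.

Section Softmax.
Context {R : realType} {n k : nat}.
Local Notation vec := 'rV[R]_n.

Definition logit (w : 'I_n -> 'I_k -> nat -> R) (psi : 'I_n -> 'I_k -> R -> R)
    (h : vec -> vec -> vec) (phi : vec -> nat -> R) (b : nat -> R)
    (i : 'I_n) (j : 'I_k) (l : nat) (p : vec * vec) : R :=
  w i j l * psi i j (h p.1 p.2 0 i) + phi p.2 l + b l.

Definition softmax (T : nat) (z : 'I_n -> 'I_k -> nat -> vec * vec -> R)
    (tau : nat) (p : vec * vec) : R :=
  expR (\sum_(i < n) \sum_(j < k) z i j tau p) /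
  \sum_(1 <= l < T.+1) expR (\sum_(i < n) \sum_(j < k) z i j l p).

End Softmax.

(* Main.v *)
Require Import Defs.
From HB Require Import structures.
From mathcomp Require Import all_boot all_order all_algebra perm.
From mathcomp Require Import all_classical all_reals all_analysis.
From mathcomp Require Import measurable_realfun ring lra zify.

Set Implicit Arguments.
Unset Strict Implicit.
Unset Printing Implicit Defensive.

Import Order.TTheory GRing.Theory Num.Theory.
Import numFieldNormedType.Exports.

Local Open Scope classical_set_scope.
Local Open Scope ring_scope.

(* By Bayes' rule the log-ratio of the posteriors of two classes is, up to a term
   depending only on x_{t-1}, both a combination of the psi_ij(h_i) and a
   combination of the q_ij(s_i).  Minimality of the order and the rank condition
   turn this into an invertible linear relation, so for g(s, x) = h(f(x, s), x)
     psi_l(g_l(s, x)) = sum_i a_{l,i}(s_i) + delta_l(x),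
   with values in R^k.  The left-hand side stays on a curve.  A curve contains
   the sum of two nonconstant curves only along a straight line, which the
   affine independence of the psi_lj excludes since k >= 2; so psi_l(g_l) depends
   on a single s_sigma(l), and not on x either.  With s_sigma(l) fixed, g_l ranges
   over an interval on which psi_l is constant.  A nondegenerate one would make
   all statistics q_sigma(l) constant on an interval, against strong
   exponentiality and the rank condition; so g_l is a function of s_sigma(l). *)

(** * Sums of curves inside a curve *)

Lemma derive1_approx (R : realType) (a : R -> R) (v0 eps : R) :
  derivable a v0 1 -> 0 < eps ->
  exists2 eta, 0 < eta & forall v, `|v - v0| <= eta ->
    `|a v - a v0 - (v - v0) * derive1 a v0| <= eps * `|v - v0|.
Proof.
move=> da eps0; have := da => /cvg_ex[/= l].
rewrite derive1E /derive => hl; rewrite (cvg_lim _ hl)//.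
move/cvgrPdist_le : hl => /(_ _ eps0) /nbhs_ballP[eta /= eta0 H].
exists (eta / 2) => [|v hv]; first by rewrite divr_gt0.
have [->|vv0] := eqVneq v v0; first by rewrite !subrr mul0r subr0 normr0 mulr0.
have d0 : v - v0 != 0 by rewrite subr_eq0.
have := H (v - v0); rewrite /ball /= sub0r normrN => /(_ _ d0).
rewrite (le_lt_trans hv) => [/(_ isT)|]; last by rewrite ltr_pdivrMr// ltr_pMr// ltr1n.
rewrite /GRing.scale/= mulr1 subrK => {}H.
rewrite -normrN opprB.
have -> : (v - v0) * l - (a v - a v0) = (l - (v - v0)^-1 * (a v - a v0)) * (v - v0).
  by field.
by rewrite normrM ler_wpM2r.
Qed.

(** With an error of at most half the slope, [a] stays strictly above [a v0] on one side of [v0] and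
    strictly below on the other, so a value common to both sides forces [u = v0 = v].
    Differentiability at one point gives no injectivity on a neighbourhood. *)
Lemma derive1_neq0_straddle (R : realType) (a : R -> R) (v0 : R) :
  derivable a v0 1 -> derive1 a v0 != 0 ->
  exists2 eta, 0 < eta & forall u v, v0 - eta <= u <= v0 -> v0 <= v <= v0 + eta ->
    a u = a v -> u = v.
Proof.
move=> da D0; have D2 : 0 < `|derive1 a v0| / 2 by rewrite divr_gt0// normr_gt0.
have [eta eta0 H] := derive1_approx da D2.
exists eta => // u v /andP[u1 u2] /andP[v1 v2] auv.
have hu : `|u - v0| <= eta by rewrite ler_norml; apply/andP; split; lra.
have hv : `|v - v0| <= eta by rewrite ler_norml; apply/andP; split; lra.
have := H _ hu; have := H _ hv; rewrite -auv.
have -> : `|u - v0| = v0 - u by rewrite ler0_norm; lra.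
have -> : `|v - v0| = v - v0 by rewrite ger0_norm; lra.
rewrite !ler_norml => /andP[K1 K2] /andP[K3 K4].
have [Dp|Dn|/eqP] := ltrgtP (derive1 a v0) 0; last by rewrite (negbTE D0).
- move: K1 K2 K3 K4 D2; rewrite ltr0_norm// => K1 K2 K3 K4 D2.
  suff : v - u <= 0 by lra.
  have : (v - u) * - derive1 a v0 <= 0 by lra.
  by rewrite pmulr_lle0 ?oppr_gt0.
- move: K1 K2 K3 K4 D2; rewrite gtr0_norm// => K1 K2 K3 K4 D2.
  suff : v - u <= 0 by lra.
  have : (v - u) * derive1 a v0 <= 0 by lra.
  by rewrite pmulr_lle0.
Qed.

Lemma IVT_continuous (R : realType) (f : R -> R) (a b y : R) :
  continuous f -> a <= b -> Num.min (f a) (f b) <= y <= Num.max (f a) (f b) ->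
  exists2 v, a <= v <= b & f v = y.
Proof.
move=> cf ab hy; have [|v + fv] := IVT ab _ hy; first exact: continuous_subspaceT.
by rewrite in_itv/= => hv; exists v.
Qed.

(** By the straddling property [f] takes [f (v0 + eta)] nowhere on the left half and [f (v0 - eta)]
    nowhere on the right half. Were both on the same side of [f v0], the intermediate value theorem
    would reach the one closer to [f v0] from the opposite half. *)
Lemma strict_crossing (R : realType) (f a : R -> R) (v0 eps : R) :
  continuous f -> (forall u v, f u = f v -> a u = a v) ->
  derivable a v0 1 -> derive1 a v0 != 0 -> 0 < eps ->
  exists2 eta, 0 < eta < eps & (f (v0 + eta) - f v0) * (f (v0 - eta) - f v0) < 0.
Proof.
move=> cf fa da D0 eps0; have [e e0 H] := derive1_neq0_straddle da D0.
pose eta := Num.min e (eps / 2).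
have eta0 : 0 < eta by rewrite lt_min e0 divr_gt0.
have etae : eta <= e by rewrite ge_min lexx.
have etaeps : eta < eps by rewrite gt_min; apply/orP; right; lra.
exists eta; first by rewrite eta0.
rewrite ltNge; apply/negP => K.
have Hp u : v0 - eta <= u <= v0 -> f u <> f (v0 + eta).
  move=> /andP[u1 u2] /fa auv.
  have := H u (v0 + eta); rewrite auv => /(_ _ _ erefl) E.
  have : u = v0 + eta by apply: E; apply/andP; split; lra.
  by move=> ?; lra.
have Hm u : v0 <= u <= v0 + eta -> f u <> f (v0 - eta).
  move=> /andP[u1 u2] /fa auv.
  have := H (v0 - eta) u; rewrite auv => /(_ _ _ erefl) E.
  have : v0 - eta = u by apply: E; apply/andP; split; lra.
  by move=> ?; lra.
have I1 y : Num.min (f (v0 - eta)) (f v0) <= y <= Num.max (f (v0 - eta)) (f v0) ->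
    y <> f (v0 + eta).
  by move=> /(IVT_continuous cf) [|v hv <-]; [lra|exact: Hp].
have I2 y : Num.min (f v0) (f (v0 + eta)) <= y <= Num.max (f v0) (f (v0 + eta)) ->
    y <> f (v0 - eta).
  by move=> /(IVT_continuous cf) [|v hv <-]; [lra|exact: Hm].
have {I1 I2} := (I1 (f (v0 + eta)), I2 (f (v0 - eta))).
have N1 : f v0 <> f (v0 + eta) by apply: Hp; lra.
have N2 : f v0 <> f (v0 - eta) by apply: Hm; lra.
move: (f v0) (f (v0 + eta)) (f (v0 - eta)) K N1 N2 => x y z K N1 N2 [I1 I2].
have {}I1 : ~ (Num.min z x <= y <= Num.max z x) by move=> /I1.
have {}I2 : ~ (Num.min x y <= z <= Num.max x y) by move=> /I2.
move: I1 I2; rewrite !ge_min !le_max.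
have [yx|yx|/esym//] := ltrgtP y x; have [zx|zx|/esym//] := ltrgtP z x;
  rewrite ?orbT ?orbF ?andbT /= => /negP I1 /negP I2; rewrite -!ltNge in I1 I2.
- by move: (lt_trans I1 I2); rewrite ltxx.
- have : 0 < (x - y) * (z - x) by rewrite mulr_gt0 ?subr_gt0.
  by lra.
- have : 0 < (y - x) * (x - z) by rewrite mulr_gt0 ?subr_gt0.
  by lra.
- by move: (lt_trans I1 I2); rewrite ltxx.
Qed.

(** The strict sign change of [Y v t0 - Y v0 t0] between [v0 - eta] and [v0 + eta] survives a small
    change of [t0]; the intermediate value theorem in [v] then finds the level, for each [t]
    separately. *)
Lemma level_curve_near (R : realType) (Y : R -> R -> R) (a : R -> R) (v0 t0 eps : R) :
  continuous (fun z : R * R => Y z.1 z.2) ->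
  (forall u v, Y u t0 = Y v t0 -> a u = a v) ->
  derivable a v0 1 -> derive1 a v0 != 0 -> 0 < eps ->
  \forall t \near t0, exists2 v, `|v - v0| < eps & Y v t = Y v0 t0.
Proof.
move=> cY Ya da D0 eps0.
have c1 t : continuous (Y ^~ t).
  by move=> v; apply: (@continuous2_cvg R _ _ _ (nbhs v) _ id (cst t) Y v t (cY (v, t)));
    [exact: cvg_id|exact: cvg_cst].
have c2 v : continuous (Y v).
  by move=> t; apply: (@continuous2_cvg R _ _ _ (nbhs t) _ (cst v) id Y v t (cY (v, t)));
    [exact: cvg_cst|exact: cvg_id].
have [eta /andP[eta0 etaeps] H] := strict_crossing (c1 t0) Ya da D0 eps0.
have cP : (fun t => (Y (v0 + eta) t - Y v0 t0) * (Y (v0 - eta) t - Y v0 t0)) @ t0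
    --> (Y (v0 + eta) t0 - Y v0 t0) * (Y (v0 - eta) t0 - Y v0 t0).
  by apply: cvgM; apply: cvgB; try exact: cvg_cst; exact: c2.
near=> t.
have Ht : (Y (v0 + eta) t - Y v0 t0) * (Y (v0 - eta) t - Y v0 t0) < 0.
  by near: t; apply: (cvgr_lt _ cP).
have [||v /andP[v1 v2] hv] := @IVT_continuous R (Y ^~ t) (v0 - eta) (v0 + eta) (Y v0 t0) (c1 t).
- by lra.
- rewrite ge_min le_max; move: (Y (v0 + eta) t) (Y (v0 - eta) t) (Y v0 t0) Ht => y z x K.
  have [yx|yx|yx] := ltrgtP y x; have [zx|zx|zx] := ltrgtP z x => //=.
  + have : 0 < (x - y) * (x - z) by rewrite mulr_gt0 ?subr_gt0.
    by lra.
  + have : 0 < (y - x) * (z - x) by rewrite mulr_gt0 ?subr_gt0.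
    by lra.
- by exists v => //; rewrite ltr_norml; apply/andP; split; lra.
Unshelve. all: by end_near. Qed.

Lemma locally_constant_cst (R : realType) (b : R -> R) :
  (forall t, \forall t' \near t, b t' = b t) -> forall t t', b t = b t'.
Proof.
move=> bt t t'; apply: is_derive_0_is_cst => x.
apply: (@near_eq_is_derive _ _ _ (cst (b x))).
by apply: filterS (bt x) => y ->.
Qed.

(** A displacement [d] close both to [h * D] and to [h' * E] forces [D] and [E] to be almost
    parallel. The cross product is bounded after multiplication by [|h|] and by [|h'|]; adding the
    bounds leaves the factor [|h| + |h'|], positive because [h] is nonzero. *)
Lemma cross_product_bound (R : realFieldType) (D1 D2 E1 E2 h h' d1 d2 eps : R) :
  h != 0 -> `|d1 - h * D1| <= eps * `|h| -> `|d2 - h * D2| <= eps * `|h| ->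
  `|d1 - h' * E1| <= eps * `|h'| -> `|d2 - h' * E2| <= eps * `|h'| ->
  `|D1 * E2 - D2 * E1| <= eps * (`|D1| + `|D2| + `|E1| + `|E2|).
Proof.
move=> h0 K1 K2 K3 K4; set c := D1 * E2 - D2 * E1; set M := (X in eps * X).
have S0 : 0 < `|h| + `|h'| by rewrite ltr_pwDl ?normr_gt0.
have X1 : `|h * D1 - h' * E1| <= eps * (`|h| + `|h'|).
  have -> : h * D1 - h' * E1 = (d1 - h' * E1) - (d1 - h * D1) by ring.
  by rewrite (le_trans (ler_normB _ _))// mulrDr addrC lerD.
have X2 : `|h * D2 - h' * E2| <= eps * (`|h| + `|h'|).
  have -> : h * D2 - h' * E2 = (d2 - h' * E2) - (d2 - h * D2) by ring.
  by rewrite (le_trans (ler_normB _ _))// mulrDr addrC lerD.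
rewrite -(ler_pM2l S0).
have C1 : `|h| * `|c| <= eps * (`|h| + `|h'|) * (`|E1| + `|E2|).
  rewrite -normrM.
  have -> : h * c = (h * D1 - h' * E1) * E2 - (h * D2 - h' * E2) * E1.
    by rewrite /c; ring.
  by rewrite (le_trans (ler_normB _ _))// !normrM mulrDr addrC lerD// ler_wpM2r.
have C2 : `|h'| * `|c| <= eps * (`|h| + `|h'|) * (`|D1| + `|D2|).
  rewrite -normrM.
  have -> : h' * c = (h * D1 - h' * E1) * D2 - (h * D2 - h' * E2) * D1.
    by rewrite /c; ring.
  by rewrite (le_trans (ler_normB _ _))// !normrM mulrDr addrC lerD// ler_wpM2r.
have -> : (`|h| + `|h'|) * (eps * M) = eps * (`|h| + `|h'|) * (`|E1| + `|E2|) +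
   eps * (`|h| + `|h'|) * (`|D1| + `|D2|) by rewrite /M; ring.
by rewrite mulrDl lerD.
Qed.

Section SumOfCurves.
Variables (R : realType) (Y : R -> R -> R) (p1 p2 a1 a2 b1 b2 : R -> R) (v0 : R).
Hypothesis cY : continuous (fun z : R * R => Y z.1 z.2).
Hypothesis pY1 : forall v t, p1 (Y v t) = a1 v + b1 t.
Hypothesis pY2 : forall v t, p2 (Y v t) = a2 v + b2 t.
Hypothesis da1 : forall v, derivable a1 v 1.
Hypothesis da2 : forall v, derivable a2 v 1.
Hypothesis D0 : derive1 a1 v0 != 0.

Let level v t0 eps : (derive1 a1 v != 0) || (derive1 a2 v != 0) -> 0 < eps ->
  \forall t \near t0, exists v', [/\ `|v' - v| < eps,
    a1 v' - a1 v = b1 t0 - b1 t & a2 v' - a2 v = b2 t0 - b2 t].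
Proof.
move=> Dv e0.
have Ya1 x y : Y x t0 = Y y t0 -> a1 x = a1 y.
  by move=> E; apply: (@addIr _ (b1 t0)); rewrite -!pY1 E.
have Ya2 x y : Y x t0 = Y y t0 -> a2 x = a2 y.
  by move=> E; apply: (@addIr _ (b2 t0)); rewrite -!pY2 E.
have : \forall t \near t0, exists2 v', `|v' - v| < eps & Y v' t = Y v t0.
  by case/orP: Dv => Dv; [apply: level_curve_near cY Ya1 _ Dv e0|
                          apply: level_curve_near cY Ya2 _ Dv e0].
apply: filterS => t [v' hv' E]; exists v'; split => //.
- by have := congr1 p1 E; rewrite !pY1; lra.
- by have := congr1 p2 E; rewrite !pY2; lra.
Qed.

(* Along a level curve of [Y] a small displacement of [b] is compensated by a
   displacement of [a] near any prescribed [v] with nonzero tangent, so if [b]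
   moves then all tangents of [a] are parallel; [b] then moves along the same
   direction. *)
Lemma sum_of_curves_in_curve :
  (forall t t', b1 t = b1 t' /\ b2 t = b2 t') \/
  (forall v t v' t', derive1 a1 v0 * p2 (Y v t) - derive1 a2 v0 * p1 (Y v t) =
    derive1 a1 v0 * p2 (Y v' t') - derive1 a2 v0 * p1 (Y v' t')).
Proof.
(* Unless [b] is locally constant, hence constant, it moves arbitrarily close to some [t0]. *)
have [bt|/existsNP[t0 bt0]] := pselect (forall t, \forall t' \near t, b1 t' = b1 t /\ b2 t' = b2 t).
  left=> t t'; split; apply: locally_constant_cst => x.
    by apply: filterS (bt x) => y [].
  by apply: filterS (bt x) => y [].
right; set D1 := derive1 a1 v0; set D2 := derive1 a2 v0.
have par v1 : D1 * derive1 a2 v1 - D2 * derive1 a1 v1 = 0.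
  set E1 := derive1 a1 v1; set E2 := derive1 a2 v1.
  have [E0|E0] := boolP ((E1 != 0) || (E2 != 0)); last first.
    by move: E0; rewrite negb_or !negbK => /andP[/eqP -> /eqP ->]; rewrite !mulr0 subrr.
  apply/eqP/negPn/negP => c0; rewrite -normr_gt0 in c0.
  pose M := `|D1| + `|D2| + `|E1| + `|E2|.
  have M0 : 0 <= M by rewrite !addr_ge0.
  (* Chosen so that [eps * M], the bound given by [cross_product_bound], is strictly below the cross
     product. *)
  pose eps := `|D1 * E2 - D2 * E1| / (M + 1).
  have eps0 : 0 < eps by rewrite divr_gt0//; lra.
  have [e1 e10 A1] := derive1_approx (@da1 v0) eps0.
  have [e2 e20 A2] := derive1_approx (@da2 v0) eps0.
  have [e3 e30 A3] := derive1_approx (@da1 v1) eps0.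
  have [e4 e40 A4] := derive1_approx (@da2 v1) eps0.
  pose e := Num.min (Num.min e1 e2) (Num.min e3 e4).
  have e0 : 0 < e by rewrite !lt_min e10 e20 e30 e40.
  have : ~ \forall t \near t0, `|D1 * E2 - D2 * E1| > eps * M -> b1 t = b1 t0 /\ b2 t = b2 t0.
    move=> K; apply: bt0; apply: filterS K => t; apply.
    rewrite /eps -mulrA gtr_pMr// mulrC ltr_pdivrMr; lra.
  apply; have D0' : (derive1 a1 v0 != 0) || (derive1 a2 v0 != 0) by rewrite D0.
  apply: filterS2 (level t0 D0' e0) (level t0 E0 e0) => t [v [hv F1 F2]] [v' [hv' G1 G2]] K.
  (* With no displacement of [a] at [v0], [b] has not moved; otherwise [v - v0] is the nonzero [h]
     of [cross_product_bound]. *)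
  have [vv0|vv0] := eqVneq v v0; first by move: F1 F2; rewrite vv0 !subrr; lra.
  exfalso; move: hv hv'; rewrite !lt_min => /andP[/andP[h1 h2] _] /andP[_ /andP[h3 h4]].
  have := @cross_product_bound _ D1 D2 E1 E2 (v - v0) (v' - v1) (b1 t0 - b1 t) (b2 t0 - b2 t) eps.
  rewrite subr_eq0 -{1}F1 -{1}F2 -{1}G1 -{1}G2 =>
    /(_ vv0 (A1 _ (ltW h1)) (A2 _ (ltW h2)) (A3 _ (ltW h3)) (A4 _ (ltW h4))).
  by rewrite leNgt K.
have ca v v' : D1 * a2 v - D2 * a1 v = D1 * a2 v' - D2 * a1 v'.
  apply: (@is_derive_0_is_cst _ (fun v => D1 * a2 v - D2 * a1 v)) => x.
  have H1 : is_derive x (1 : R) a1 (derive1 a1 x) by rewrite derive1E; apply: derivableP.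
  have H2 : is_derive x (1 : R) a2 (derive1 a2 x) by rewrite derive1E; apply: derivableP.
  rewrite -(par x).
  have := is_deriveB (is_deriveZ D1 H2) (is_deriveZ D2 H1).
  by [].
(* [b] inherits the invariant from [a] through level curves, locally in [t]; local constancy takes
   the place of a derivative. *)
have cb t t' : D1 * b2 t - D2 * b1 t = D1 * b2 t' - D2 * b1 t'.
  apply: (@locally_constant_cst _ (fun t => D1 * b2 t - D2 * b1 t)) => x.
  have D0' : (derive1 a1 v0 != 0) || (derive1 a2 v0 != 0) by rewrite D0.
  apply: filterS (level x D0' ltr01) => y [v [_ F1 F2]].
  have := ca v v0.
  have -> : a1 v = a1 v0 + (b1 x - b1 y) by lra.
  have -> : a2 v = a2 v0 + (b2 x - b2 y) by lra.
  by lra.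
move=> v t v' t'; rewrite !pY1 !pY2; have := ca v v'; have := cb t t'.
by lra.
Qed.

End SumOfCurves.

(** * Component-wise separation *)

Section ComponentwiseSeparation.
Variables (R : realType) (n k : nat).
Local Notation vec := 'rV[R]_n.
Variables (psi q : 'I_n -> 'I_k -> R -> R) (g : vec -> vec -> vec)
  (alpha : 'I_n -> 'I_k -> 'I_n -> R -> R).
Hypothesis k_ge2 : (2 <= k)%N.
Hypothesis g_cont : continuous (fun p : vec * vec => g p.1 p.2).
Hypothesis g_inj : forall x, injective (g ^~ x).
Hypothesis g_surj : forall x y, exists s, g s x = y.
Hypothesis alpha_der : forall l j i v, derivable (alpha l j i) v 1.
Hypothesis psi_sep : forall l j s s' x,
  psi l j (g s x 0 l) - psi l j (g s' x 0 l) =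
  \sum_i (alpha l j i (s 0 i) - alpha l j i (s' 0 i)).
Hypothesis psi_indep : forall (i : 'I_n) (theta : 'I_k -> R),
  (exists c : R, forall y : R, \sum_(j < k) psi i j y * theta j = c) ->
  forall j, theta j = 0.
Hypothesis q_psi : forall s s' x,
  (forall l j, psi l j (g s x 0 l) = psi l j (g s' x 0 l)) ->
  forall i j, q i j (s 0 i) = q i j (s' 0 i).
Hypothesis q_nonconst : forall i a b, a < b ->
  ~ forall j, exists c, forall v, a < v < b -> q i j v = c.

Let upd (s : vec) i v : vec := s + (v - s 0 i) *: delta_mx 0 i.

Let updE s i v m : upd s i v 0 m = if m == i then v else s 0 m.
Proof.
by rewrite !mxE eqxx/=; case: eqVneq => [->|_]; rewrite ?mulr1 ?mulr0 ?addr0// addrC subrK.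
Qed.

Let upd_id s i : upd s i (s 0 i) = s.
Proof. by rewrite /upd subrr scale0r addr0. Qed.

Let line (s s' : vec) (r : R) : vec := s + r *: (s' - s).

Let line0 s s' : line s s' 0 = s. Proof. by rewrite /line scale0r addr0. Qed.
Let line1 s s' : line s s' 1 = s'. Proof. by rewrite /line scale1r addrC subrK. Qed.

Let line_cont s s' : continuous (line s s').
Proof.
move=> r; apply: cvgD; first exact: cvg_cst.
by apply: cvgZr_tmp; exact: cvg_id.
Qed.

(** [v] moves coordinate [i] of the innovation, [r] moves all the rest and the past from [(s, x)] to
    [(s', x')]. This puts every influence other than that of coordinate [i] into the curve [b] of
    [sum_of_curves_in_curve]. *)
Let Y l i s x s' x' (v r : R) : R := g (upd (line s s' r) i v) (line x x' r) 0 l.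

Let g_coord_cont l : continuous (fun p : vec * vec => g p.1 p.2 0 l).
Proof.
move=> p; apply: (@continuous_comp _ _ _ (fun p : vec * vec => g p.1 p.2) (fun M : vec => M 0 l)).
  exact: g_cont.
exact: coord_continuous.
Qed.

Let Y_cont l i s x s' x' : continuous (fun z : R * R => Y l i s x s' x' z.1 z.2).
Proof.
move=> z; apply: (@continuous2_cvg _ vec vec R (nbhs z) _
  (fun z => upd (line s s' z.2) i z.1) (fun z => line x x' z.2) (fun s x => g s x 0 l)
  (upd (line s s' z.2) i z.1) (line x x' z.2)); first exact: (@g_coord_cont l (_, _)).
  have L : line s s' y.2 @[y --> z] --> line s s' z.2.
    by apply: (@continuous_comp _ _ _ (@snd R R) (line s s')); [exact: cvg_snd|exact: line_cont].
  apply: cvgD; first exact: L.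
  apply: cvgZr_tmp; apply: cvgB; first exact: cvg_fst.
  by apply: (@continuous_comp _ _ _ (fun z : R * R => line s s' z.2) (fun M : vec => M 0 i));
    [exact: L|exact: coord_continuous].
by apply: (@continuous_comp _ _ _ (@snd R R) (line x x')); [exact: cvg_snd|exact: line_cont].
Qed.

Let psi_Y l j i s x s' x' v r :
  psi l j (Y l i s x s' x' v r) = alpha l j i v + (psi l j (Y l i s x s' x' 0 r) - alpha l j i 0).
Proof.
have := psi_sep l j (upd (line s s' r) i v) (upd (line s s' r) i 0) (line x x' r).
rewrite (bigD1 i)//= big1 => [|m /negbTE mi]; last by rewrite !updE mi subrr.
by rewrite !updE eqxx /Y; lra.
Qed.

(** Either the influence [b] is constant on the path from [(s, x)] to [(s', x')], as claimed, or the
    pair of functions stays on a line. In the latter case the linear form [c] is constant along [g],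
    hence everywhere since [g] is onto, against the affine independence of [psi l]. *)
Let psi_pair_dep l j i v0 j' (s x s' x' : vec) : derive1 (alpha l j i) v0 != 0 -> j' != j ->
  s 0 i = s' 0 i ->
  psi l j (g s x 0 l) = psi l j (g s' x' 0 l) /\ psi l j' (g s x 0 l) = psi l j' (g s' x' 0 l).
Proof.
move=> D0 jj' si.
pose b m s x s' x' r := psi l m (Y l i s x s' x' 0 r) - alpha l m i 0.
pose D1 := derive1 (alpha l j i) v0; pose D2 := derive1 (alpha l j' i) v0.
pose c y := D1 * psi l j' y - D2 * psi l j y.
have U s1 x1 s2 x2 : (forall r r', b j s1 x1 s2 x2 r = b j s1 x1 s2 x2 r' /\
      b j' s1 x1 s2 x2 r = b j' s1 x1 s2 x2 r') \/
    (forall v r v' r', c (Y l i s1 x1 s2 x2 v r) = c (Y l i s1 x1 s2 x2 v' r')).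
  exact: (@sum_of_curves_in_curve R _ (psi l j) (psi l j') (alpha l j i) (alpha l j' i)
    (b j s1 x1 s2 x2) (b j' s1 x1 s2 x2) v0 (@Y_cont l i s1 x1 s2 x2) (psi_Y l j i s1 x1 s2 x2)
    (psi_Y l j' i s1 x1 s2 x2) (@alpha_der l j i) (@alpha_der l j' i) D0).
have Y0 s1 x1 s2 x2 : Y l i s1 x1 s2 x2 (s1 0 i) 0 = g s1 x1 0 l.
  by rewrite /Y !line0 upd_id.
have Y1 s1 x1 s2 x2 : Y l i s1 x1 s2 x2 (s2 0 i) 1 = g s2 x2 0 l.
  by rewrite /Y !line1 upd_id.
have [H|H] := U s x s' x'.
  have [H1 H2] := H 0 1.
  rewrite -(Y0 s x s' x') -(Y1 s x s' x') si.
  by split; rewrite [LHS]psi_Y [RHS]psi_Y; congr (_ + _).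
exfalso.
(* Invariance along [alpha] does not involve the endpoints, so it carries over to the families [Y]
   between all other endpoints: where [b] is constant, [c] changes only through [alpha], hence not
   at all. *)
have ca v v' : D1 * alpha l j' i v - D2 * alpha l j i v = D1 * alpha l j' i v' - D2 * alpha l j i v'.
  have := H v 0 v' 0; rewrite /c (psi_Y l j i s x s' x' v) (psi_Y l j i s x s' x' v').
  by rewrite (psi_Y l j' i s x s' x' v) (psi_Y l j' i s x s' x' v'); lra.
have cg s1 x1 s2 x2 : c (g s1 x1 0 l) = c (g s2 x2 0 l).
  rewrite -(Y0 s1 x1 s2 x2) -(Y1 s1 x1 s2 x2).
  have [H'|H'] := U s1 x1 s2 x2; last exact: H'.
  have [+ +] := H' 0 1; rewrite /b => H1 H2.
  rewrite /c (psi_Y l j i s1 x1 s2 x2 _ 0) (psi_Y l j i s1 x1 s2 x2 _ 1).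
  rewrite (psi_Y l j' i s1 x1 s2 x2 _ 0) (psi_Y l j' i s1 x1 s2 x2 _ 1) H1 H2.
  by have := ca (s1 0 i) (s2 0 i); lra.
have cc y : c y = c (g 0 0 0 l).
  have [s1 E] := g_surj 0 (const_mx y).
  by rewrite -(cg s1 0); rewrite E mxE.
have := @psi_indep l (fun m => if m == j then - D2 else if m == j' then D1 else 0).
move=> /(_ _ j') /=; rewrite (negbTE jj') eqxx => E.
suff : D1 = 0 by move/eqP; rewrite (negbTE D0).
apply: E; exists (c (g 0 0 0 l)) => y.
rewrite -(cc y) (bigD1 j)//= eqxx (bigD1 j')//= (negbTE jj') eqxx big1.
  by rewrite /c; lra.
by move=> m /andP[/negbTE -> /negbTE ->]; rewrite mulr0.
Qed.

(** If all slopes vanished, [psi l j0] would be constant along [g], hence everywhere since [g] is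
    onto, and the indicator of [j0] would be a forbidden [theta]. *)
Let alpha_nonconst l : exists j i v, derive1 (alpha l j i) v != 0.
Proof.
have [j0 _] : exists j0 : 'I_k, True by exists (Ordinal (ltnW k_ge2)).
apply: contrapT => H.
have ac j i v v' : alpha l j i v = alpha l j i v'.
  apply: is_derive_0_is_cst => x.
  have <- : derive1 (alpha l j i) x = 0.
    by apply: contrapT => /eqP K; apply: H; exists j, i, x.
  by rewrite derive1E; apply: derivableP; apply: alpha_der.
have := @psi_indep l (fun m => (m == j0)%:R).
move=> /(_ _ j0) /=; rewrite eqxx => E; suff : (1 : R) = 0 by move/eqP; rewrite oner_eq0.
apply: E; exists (psi l j0 (g 0 0 0 l)) => y.
rewrite (bigD1 j0)//= eqxx mulr1 big1 ?addr0; last by move=> m /negbTE ->; rewrite mulr0.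
have [s E] := g_surj 0 (const_mx y).
have := psi_sep l j0 s 0 0; rewrite big1 => [|m _]; last by rewrite (ac _ _ _ ((0 : vec) 0 m)) subrr.
by rewrite E mxE => /eqP; rewrite subr_eq0 => /eqP.
Qed.

Lemma componentwise_separation : exists (sigma : 'S_n) (c : 'I_n -> R -> R),
  (forall i, bijective (c i)) /\
  forall (s x : vec) i, g s x 0 i = c i (s 0 (sigma i)).
Proof.
have [sigma Hs] : {sigma : 'I_n -> 'I_n &
    forall l, exists j v, derive1 (alpha l j (sigma l)) v != 0}.
  apply: (@choice _ _ (fun l i => exists j v, derive1 (alpha l j i) v != 0)) => l.
  by have [j [i [v H]]] := alpha_nonconst l; exists i, j, v.
(* [psi_pair_dep] treats a pair of distinct indices; for [j = j1] a partner [j2] exists because [k]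
   is at least 2. *)
have dep l j (s x s' x' : vec) : s 0 (sigma l) = s' 0 (sigma l) ->
    psi l j (g s x 0 l) = psi l j (g s' x' 0 l).
  move=> E; have [j1 [v D0]] := Hs l.
  have [->|jj] := eqVneq j j1; last by have [] := psi_pair_dep x x' D0 jj E.
  have [j2 jj2] : exists j2, j2 != j1.
    have [->|] := eqVneq j1 (Ordinal (ltnW k_ge2)); last by
      rewrite eq_sym; exists (Ordinal (ltnW k_ge2)).
    by exists (Ordinal k_ge2).
  by have [] := psi_pair_dep x x' D0 jj2 E.
(* If [sigma] missed [i], moving [s 0 i] would leave every [psi l m] unchanged, and [q_psi] would
   make all statistics of [i] constant. *)
have sigma_surj i : exists l, sigma l = i.
  apply: contrapT => /forallNP H.
  apply: (@q_nonconst i 0 1 ltr01) => j; exists (q i j 0) => v _.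
  have := @q_psi (upd 0 i v) 0 0 _ i j; rewrite updE eqxx mxE; apply => l m.
  by apply: dep; rewrite updE; case: eqP => // /H.
have sigma_inj : injective sigma.
  have [tau tauK] := choice sigma_surj.
  by apply: bij_inj; apply: (bij_can_bij (injF_bij (can_inj tauK)) tauK).
(* Choose [s] with [g s 0 0 l] at the midpoint. Small moves of its coordinate [sigma l] keep this
   value in the interval, and the other [psi l'] do not see them since [sigma] is injective; so all
   [q (sigma l) j] would be constant on an interval. *)
have nonconst l y y' : y < y' -> ~ forall j z, y <= z <= y' -> psi l j z = psi l j y.
  move=> yy' K; have [s E] := g_surj 0 (const_mx ((y + y') / 2)).
  have sl : g s 0 0 l = (y + y') / 2 by rewrite E mxE.
  have C := @Y_cont l (sigma l) s 0 s 0 (s 0 (sigma l), 0).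
  have Cv : (fun v => Y l (sigma l) s 0 s 0 v 0) @ (s 0 (sigma l)) --> g s 0 0 l.
    have := (@continuous2_cvg R _ _ _ (nbhs (s 0 (sigma l))) _ id (cst (0 : R))
      (Y l (sigma l) s 0 s 0) (s 0 (sigma l)) 0 C).
    rewrite /Y !line0 upd_id; apply; [exact: cvg_id|exact: cvg_cst].
  have : \forall v \near s 0 (sigma l), y < Y l (sigma l) s 0 s 0 v 0 < y'.
    near=> v; apply/andP; split; near: v.
      by apply: (cvgr_gt _ Cv); rewrite sl; lra.
    by apply: (cvgr_lt _ Cv); rewrite sl; lra.
  move=> /nbhs_ballP[e /= e0 He].
  apply: (@q_nonconst (sigma l) (s 0 (sigma l) - e) (s 0 (sigma l) + e)); first by lra.
  move=> j; exists (q (sigma l) j (s 0 (sigma l))) => v hv.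
  have := @q_psi (upd s (sigma l) v) s 0 _ (sigma l) j; rewrite updE eqxx; apply => l' m.
  have [->|ll'] := eqVneq l' l; last first.
    by apply: dep; rewrite updE; case: eqVneq => // /sigma_inj /eqP; rewrite (negbTE ll').
  have := He v; rewrite /ball/= ltr_norml => /(_ _)/andP[|h1 h2].
    by apply/andP; split; lra.
  have h3 : Y l (sigma l) s 0 s 0 v 0 = g (upd s (sigma l) v) 0 0 l by rewrite /Y !line0.
  rewrite -h3 (K m (Y _ _ _ _ _ _ _ _)); last by rewrite !ltW.
  by rewrite (K m (g s 0 0 l))// sl; apply/andP; split; lra.
have gdep l (s x s' x' : vec) : s 0 (sigma l) = s' 0 (sigma l) -> g s x 0 l = g s' x' 0 l.
  move=> E.
  (* Along the segment [dep] keeps [psi l] fixed; by the intermediate value theorem it is constant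
     between the end values of [gam], which must then agree. *)
  pose gam r := g (line s s' r) (line x x' r) 0 l.
  have gamc : continuous gam.
    move=> r; apply: (@continuous2_cvg _ vec vec R (nbhs r) _ (line s s') (line x x')
      (fun s x => g s x 0 l) (line s s' r) (line x x' r)); first exact: (@g_coord_cont l (_, _)).
      exact: line_cont.
    exact: line_cont.
  have gam0 : gam 0 = g s x 0 l by rewrite /gam !line0.
  have gam1 : gam 1 = g s' x' 0 l by rewrite /gam !line1.
  have gamp j z : Num.min (gam 0) (gam 1) <= z <= Num.max (gam 0) (gam 1) ->
      psi l j z = psi l j (g s x 0 l).
    move=> /(IVT_continuous gamc ler01)[r _ <-]; apply: dep.
    by rewrite !mxE E; ring.
  have [lt01|lt10|] := ltrgtP (gam 0) (gam 1); last by rewrite gam0 gam1.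
    exfalso; apply: (nonconst l _ _ lt01) => j z hz; rewrite gam0.
    by apply: gamp; rewrite min_l ?max_r// ltW.
  exfalso; apply: (nonconst l _ _ lt10) => j z hz.
  have gle := ltW lt10; rewrite (gamp j z); last by rewrite min_r// max_l.
  by rewrite gamp// min_r// max_l// lexx.
pose c l v := g (const_mx v) 0 0 l.
have gc (s x : vec) l : g s x 0 l = c l (s 0 (sigma l)) by apply: gdep; rewrite mxE.
exists (perm sigma_inj), c; split => [l|s x i]; last by rewrite permE.
have cinj : injective (c l).
  (* Changing coordinate [sigma l] from [v] to [v'] can alter component [l] only, and [E] rules this
     out as well. *)
  move=> v v' E; pose s' := upd (const_mx v) (sigma l) v'.
  suff : g (const_mx v) 0 = g s' 0.
    move=> /(@g_inj 0) /(congr1 (fun M : vec => M 0 (sigma l))).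
    by rewrite updE eqxx mxE.
  apply/rowP => m; rewrite !gc updE mxE; by case: eqVneq => [/sigma_inj ->|].
have csurj y : exists v, c l v = y.
  have [s E] := g_surj 0 (const_mx y).
  by exists (s 0 (sigma l)); rewrite -(gc s 0) E mxE.
have [c' c'K] := choice csurj.
by exists c' => // v; apply: cinj; rewrite c'K.
Unshelve. all: by end_near. Qed.

End ComponentwiseSeparation.

(** * Invertible linear relation between the statistics *)

Lemma minimal_order_affine_indep (R : realType) (T k : nat) (Q : R -> R) (Z : nat -> R)
    (q : 'I_k -> R -> R) (lam : 'I_k -> nat -> R) (theta : 'I_k -> R) (c : R) :
  (forall v, 0 <= Q v) -> (forall tau, (1 <= tau <= T)%N -> 0 < Z tau) ->
  minimal_order T k (expfam_density Q Z q lam) ->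
  (forall v, \sum_(j < k) q j v * theta j = c) -> forall j, theta j = 0.
Proof.
move=> Q0 Z0 hmin hc j0; apply/eqP/negPn/negP => t0.
case: k j0 q lam theta hmin hc t0 => [[]//|k] j0 q lam theta hmin hc t0.
(* Solve the relation for [q j0]; the constant it leaves goes into [Z]. *)
apply: (hmin k (ltnSn k)).
exists Q, (fun tau => Z tau * expR (- (c / theta j0 * lam j0 tau))),
  (fun j => q (lift j0 j)),
  (fun j tau => lam (lift j0 j) tau - theta (lift j0 j) / theta j0 * lam j0 tau).
split => // tau htau => [|v]; first by rewrite mulr_gt0 ?Z0 ?expR_gt0.
rewrite /expfam_density.
have -> : \sum_(j < k.+1) q j v * lam j tau = c / theta j0 * lam j0 tau +
    \sum_(j < k) q (lift j0 j) v *
      (lam (lift j0 j) tau - theta (lift j0 j) / theta j0 * lam j0 tau).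
  have := hc v; rewrite !(bigD1_ord j0)//= => <-.
  have -> : \sum_(j < k) q (lift j0 j) v *
      (lam (lift j0 j) tau - theta (lift j0 j) / theta j0 * lam j0 tau) =
      \sum_(j < k) q (lift j0 j) v * lam (lift j0 j) tau -
      \sum_(j < k) q (lift j0 j) v * theta (lift j0 j) * (lam j0 tau / theta j0).
    by rewrite -sumrB; apply: eq_bigr => j _; field.
  by rewrite -mulr_suml; field.
by rewrite expRD expRN invfM invrK; ring.
Qed.

Lemma sum_mxvec_index (V : nmodType) (m n : nat) (F : 'I_(m * n) -> V) :
  \sum_r F r = \sum_i \sum_j F (mxvec_index i j).
Proof.
rewrite pair_bigA/= (reindex _ (curry_mxvec_bij m n))/=.
by apply: eq_bigr => -[i j] _.
Qed.

Lemma modulation_matrixE (R : realType) (T n k : nat) (lam : 'I_n -> 'I_k -> nat -> R) i j c :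
  modulation_matrix T lam (mxvec_index i j) c = lam i j c.+2 - lam i j 1%N.
Proof. by rewrite /modulation_matrix !mxE !mxvecE !mxE. Qed.

(** Statistics constant on an interval make each combination constant there, so strong
    exponentiality annihilates [lam i] in every class. The rows of the modulation matrix belonging
    to [i] then vanish, against full row rank. *)
Lemma strongly_exponential_nonconst (R : realType) (T n k : nat) (q : 'I_n -> 'I_k -> R -> R)
    (lam : 'I_n -> 'I_k -> nat -> R) (i : 'I_n) :
  \rank (modulation_matrix T lam) = (n * k)%N -> (1 <= k)%N ->
  strongly_exponential T (q i) (lam i) ->
  forall a b, a < b -> ~ forall j, exists c, forall v, a < v < b -> q i j v = c.
Proof.
move=> /eqP lam_free k_gt0 hs a b ab H.
have [c Hc] := choice H.
have lam0 tau j : (1 <= tau <= T)%N -> lam i j tau = 0.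
  move=> htau; apply: (hs tau htau _ j); exists a, b, (\sum_j c j * lam i j tau); split=> // v hv.
  by apply: eq_bigr => m _; rewrite Hc.
pose r := mxvec_index i (Ordinal k_gt0).
have /(row_free_inj lam_free)/matrixP/(_ 0 r) :
    (delta_mx 0 r : 'rV[R]_(n * k)) *m modulation_matrix T lam = 0 *m modulation_matrix T lam.
  rewrite -rowE mul0mx; apply/rowP => m; rewrite mxE modulation_matrixE !lam0 ?subrr ?mxE//.
    by case: m => m /= mt; lia.
  by case: m => m /= mt; lia.
by rewrite !mxE !eqxx/= => /eqP; rewrite oner_eq0.
Qed.

Section StatisticsChange.
Variables (R : realType) (n k T : nat).
Local Notation vec := 'rV[R]_n.
Variables (psi q : 'I_n -> 'I_k -> R -> R) (w lam : 'I_n -> 'I_k -> nat -> R)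
  (g : vec -> vec -> vec).
Hypothesis q_indep : forall (i : 'I_n) (theta : 'I_k -> R) (c : R),
  (forall v, \sum_(j < k) q i j v * theta j = c) -> forall j, theta j = 0.
Hypothesis lam_rank : \rank (modulation_matrix T lam) = (n * k)%N.
Hypothesis rel : forall tau : nat, (2 <= tau <= T)%N -> forall (s s' x : vec),
  \sum_i \sum_j (psi i j (g s x 0 i) - psi i j (g s' x 0 i)) * (w i j tau - w i j 1%N) =
  \sum_i \sum_j (q i j (s 0 i) - q i j (s' 0 i)) * (lam i j tau - lam i j 1%N).

Let qv (s : vec) : 'rV[R]_(n * k) := mxvec (\matrix_(i, j) q i j (s 0 i)).
Let pv (s : vec) : 'rV[R]_(n * k) := mxvec (\matrix_(i, j) psi i j (s 0 i)).

Let lam_free : row_free (modulation_matrix T lam).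
Proof. by rewrite /row_free lam_rank. Qed.

(** Full row rank gives the modulation matrix a right inverse; multiplying the matrix form of [rel]
    by it expresses differences of the [q] linearly through differences of the [psi]. *)
Let A := modulation_matrix T w *m pinvmx (modulation_matrix T lam).

Let qA s s' x : qv s - qv s' = (pv (g s x) - pv (g s' x)) *m A.
Proof.
suff E : (qv s - qv s') *m modulation_matrix T lam =
    (pv (g s x) - pv (g s' x)) *m modulation_matrix T w.
  by rewrite /A mulmxA -E -mulmxA mulmxVp// mulmx1.
apply/rowP => c; rewrite !mxE !sum_mxvec_index.
(* Column [c], counted from 0, stands for the label [c.+2], with label 1 as reference. *)
have hc : (2 <= c.+2 <= T)%N.
  by case: c => c /= ct; rewrite -ltn_predRL.
have := rel hc s s' x.
have eqF (m : 'I_n -> 'I_k -> nat -> R) (a : 'I_n -> 'I_k -> R -> R) (y y' : vec) :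
  \sum_i \sum_j (a i j (y 0 i) - a i j (y' 0 i)) * (m i j c.+2 - m i j 1%N) =
  \sum_i \sum_j (mxvec (\matrix_(i, j) a i j (y 0 i)) - mxvec (\matrix_(i, j) a i j (y' 0 i)))
    0 (mxvec_index i j) * modulation_matrix T m (mxvec_index i j) c.
  apply: eq_bigr => i _; apply: eq_bigr => j _.
  by rewrite modulation_matrixE !mxE !mxvecE !mxE.
by rewrite (eqF w psi) (eqF lam q) => ->.
Qed.

(** A vector [v] in the kernel of [A] annihilates all differences of [qv]. Varying only coordinate
    [i] turns this into an affine relation among the statistics of [i], so the block of [v]
    belonging to [i] is zero. *)
Let A_unit : A \in unitmx.
Proof.
rewrite -unitmx_tr -row_free_unit; apply: inj_row_free => v vA.
have {}vA : A *m v^T = 0 by apply: trmx_inj; rewrite trmx_mul trmxK vA trmx0.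
suff : vec_mx v = 0 by move=> /(canRL vec_mxK) ->; rewrite linear0.
apply/matrixP => i j; rewrite [RHS]mxE.
apply: (@q_indep i (fun j => vec_mx v i j) (\sum_j q i j 0 * vec_mx v i j)) => r.
apply/eqP; rewrite -subr_eq0 -sumrB; apply/eqP.
pose s : vec := \row_m (if m == i then r else 0).
have /matrixP/(_ 0 0) : (qv s - qv 0) *m v^T = 0 by rewrite (qA s 0 0) -mulmxA vA mulmx0.
rewrite !mxE sum_mxvec_index (bigD1 i)//= [X in _ + X]big1 => [|m /negbTE mi]; last first.
  by apply: big1 => l _; rewrite !mxE !mxvecE !mxE mi subrr mul0r.
rewrite addr0 => E0; rewrite -[RHS]E0; apply: eq_bigr => l _.
by rewrite !mxE !mxvecE !mxE eqxx mulrBl.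
Qed.

(** Inverting [A] expresses the left-hand side through differences of statistics. Each statistic
    involves a single coordinate of [s], and the coefficients do not involve [x]. *)
Lemma statistics_separation : exists alpha : 'I_n -> 'I_k -> 'I_n -> 'I_k -> R,
  forall l j (s s' x : vec), psi l j (g s x 0 l) - psi l j (g s' x 0 l) =
  \sum_i \sum_j' (alpha l j i j' * q i j' (s 0 i) - alpha l j i j' * q i j' (s' 0 i)).
Proof.
exists (fun l j i j' => invmx A (mxvec_index i j') (mxvec_index l j)) => l j s s' x.
have : pv (g s x) - pv (g s' x) = (qv s - qv s') *m invmx A by rewrite (qA s s' x) mulmxK.
move/rowP/(_ (mxvec_index l j)); rewrite !mxE !mxvecE !mxE => ->.
rewrite sum_mxvec_index; apply: eq_bigr => i _; apply: eq_bigr => j' _.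
by rewrite !mxE !mxvecE !mxE; ring.
Qed.

Lemma statistics_determined (s s' x : vec) :
  (forall l j, psi l j (g s x 0 l) = psi l j (g s' x 0 l)) ->
  forall i j, q i j (s 0 i) = q i j (s' 0 i).
Proof.
move=> E i j; have := qA s s' x.
have -> : pv (g s x) = pv (g s' x).
  by congr mxvec; apply/matrixP => a c; rewrite !mxE E.
rewrite subrr mul0mx => /eqP; rewrite subr_eq0 => /eqP/rowP/(_ (mxvec_index i j)).
by rewrite !mxvecE !mxE.
Qed.

End StatisticsChange.

(** * Posterior ratios *)

Section BorelRowVectors.
Variables (R : realType) (n : nat).
Local Notation vec := 'rV[R]_n.
Local Notation bvec := (borelType vec).

Lemma open_borel_measurable (A : set vec) : open A -> measurable (A : set bvec).
Proof. by move=> oA; apply: sub_sigma_algebra. Qed.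

Lemma rat_vec_ball (x : vec) (e : R) : 0 < e ->
  exists c : 'rV[rat]_n, ball (map_mx ratr c : vec) e x.
Proof.
move=> e0.
have Hc (i : 'I_n) : exists r : rat, `|ratr r - x 0 i| < e.
  have : x 0 i - e < x 0 i + e by lra.
  move=> /rat_in_itvoo[r]; rewrite in_itv/= => /andP[h1 h2]; exists r.
  by rewrite ltr_norml; apply/andP; split; lra.
have [c cP] := choice Hc.
exists (\row_i c i); split => // i j; rewrite !mxE ord1; exact: cP.
Qed.

(** An open set of the product is a countable union of boxes with rational centres and radii
    [1 / m.+1]; [G] replaces boxes that do not fit inside by the empty set. *)
Lemma open_prod_measurable (O : set (vec * vec)) : open O ->
  measurable (O : set (bvec * bvec)).
Proof.
move=> oO.
pose F (t : 'rV[rat]_n * 'rV[rat]_n * nat) : set (bvec * bvec) :=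
  ball (map_mx ratr t.1.1 : vec) (t.2.+1%:R^-1) `*` ball (map_mx ratr t.1.2 : vec) (t.2.+1%:R^-1).
pose G t : set (bvec * bvec) := [set z | F t `<=` O /\ F t z].
have -> : O = \bigcup_t G t.
  apply/seteqP; split => [[x y] Oxy|z [t _]]; last first.
    by move=> [H /H].
  have /nbhs_ballP[e /= e0 He] : nbhs (x, y) O by exact: open_nbhs_nbhs.
  have [m me] : exists m : nat, m.+1%:R^-1 < e / 2.
    by have [m _ /(_ m (leqnn _))] := near_infty_natSinv_lt (PosNum (divr_gt0 e0 (ltr0Sn _ 1))); exists m.
  have m0 : 0 < m.+1%:R^-1 :> R by rewrite invr_gt0.
  have [c1 h1] := rat_vec_ball x m0; have [c2 h2] := rat_vec_ball y m0.
  exists (c1, c2, m) => //; split; last by split.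
  move=> -[x' y'] [/= H1 H2]; apply: He; split => /=.
  - by apply: (@le_ball _ _ _ (m.+1%:R^-1 + m.+1%:R^-1)); [by rewrite (splitr e) lerD ?ltW|];
    apply: ball_triangle H1; exact: ball_sym.
  - by apply: (@le_ball _ _ _ (m.+1%:R^-1 + m.+1%:R^-1)); [by rewrite (splitr e) lerD ?ltW|];
    apply: ball_triangle H2; exact: ball_sym.
apply: countable_bigcupT_measurable; first exact: countableP.
move=> t; have [FO|FO] := pselect (F t `<=` O); last first.
  by rewrite [G t](_ : _ = set0) // -subset0 => z [].
rewrite [G t](_ : _ = F t); last by apply/seteqP; split => z // [].
by apply: measurableX; apply: open_borel_measurable; apply: ball_open; rewrite invr_gt0.
Qed.

Lemma continuous_borel_measurable (F : vec -> R) : continuous F ->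
  measurable_fun setT (F : bvec -> R).
Proof.
move=> /continuousP cF; apply: (measurability _ (RGenOpens.measurableE R)).
move=> _ [_ [a [b ->] <-]]; rewrite setTI; apply: open_borel_measurable.
exact/cF/interval_open.
Qed.

Lemma section_measurable (F : vec * vec -> R) (y : vec) :
  measurable_fun setT (F : bvec * bvec -> R) -> measurable_fun setT (fun x : bvec => F (y, x)).
Proof. by move=> mF; apply: measurableT_comp mF _; exact: (pair1_measurable (y : bvec)). Qed.

End BorelRowVectors.

Section IntegralBounds.
Variables (d : measure_display) (T : measurableType d) (R : realType)
  (mu : {measure set T -> \bar R}).
Local Open Scope ereal_scope.

Lemma ge0_integral_le_scaled (D : set T) (f g : T -> R) (c : R) :
  measurable D -> measurable_fun setT f -> measurable_fun setT g ->
  (forall x, 0 <= f x)%R -> (forall x, 0 <= g x)%R -> (0 <= c)%R ->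
  (forall x, D x -> (f x <= c * g x)%R) ->
  \int[mu]_(x in D) (f x)%:E <= c%:E * \int[mu]_(x in D) (g x)%:E.
Proof.
move=> mD mf mg f0 g0 c0 fg.
rewrite -ge0_integralZl//; last by move=> x _; rewrite lee_fin.
- apply: ge0_le_integral => //.
  + by move=> x _; rewrite lee_fin.
  + by apply/measurable_EFinP; exact: measurable_funTS.
  + apply/measurable_EFinP; apply: measurable_funTS.
    by apply: measurable_funM => //; exact: measurable_cst.
- by apply/measurable_EFinP; exact: measurable_funTS.
Qed.

Lemma integral_pos_gt0 (D : set T) (f : T -> R) :
  measurable D -> measurable_fun setT f -> (forall x, 0 < f x)%R -> 0 < mu D ->
  0 < \int[mu]_(x in D) (f x)%:E.
Proof.
move=> mD mf f0 muD; rewrite lt0e integral_ge0 ?andbT; last first.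
  by move=> x _; rewrite lee_fin ltW.
apply/eqP => I0; move: muD; rewrite lt0e => /andP[/eqP + _]; apply.
have : \int[mu]_(x in D) `|(f x)%:E| = 0.
  by rewrite -[RHS]I0; apply: eq_integral => x _; rewrite gee0_abs// lee_fin ltW.
have mfD : measurable_fun D (EFin \o f) by apply/measurable_EFinP; exact: measurable_funTS.
move/(ae_eq_integral_abs mu mD mfD) => [N [mN N0 DN]].
apply: (subset_measure0 _ mN) => // x Dx; apply: DN => /= /(_ Dx) [fx].
by have := f0 x; rewrite fx ltxx.
Qed.

End IntegralBounds.

Lemma ln_ratio_bound (R : realType) (x y a e : R) : 0 < x -> 0 < y ->
  x <= expR (a + e) * y -> y <= expR (- a + e) * x -> `|ln x - ln y - a| <= e.
Proof.
move=> x0 y0 xy yx.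
have h1 : ln x <= a + e + ln y.
  by rewrite -[a + e]expRK -lnM ?posrE ?expR_gt0// ler_ln ?posrE// mulr_gt0// expR_gt0.
have h2 : ln y <= - a + e + ln x.
  by rewrite -[- a + e]expRK -lnM ?posrE ?expR_gt0// ler_ln ?posrE// mulr_gt0// expR_gt0.
by rewrite ler_norml; apply/andP; split; lra.
Qed.

Lemma ln_prod_ord (R : realType) (n : nat) (F : 'I_n -> R) : (forall i, 0 < F i) ->
  ln (\prod_i F i) = \sum_i ln (F i).
Proof.
move=> F0; suff [] : 0 < \prod_i F i /\ ln (\prod_i F i) = \sum_i ln (F i) by [].
elim/big_ind2 : _ => [|x1 x2 y1 y2 [h1 <-] [h2 <-]|i _]; rewrite ?ln1 ?ltr01//.
by rewrite mulr_gt0// lnM.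
Qed.

Section PosteriorRatio.
Variables (R : realType) (n T : nat) (d : measure_display) (Omega : measurableType d)
  (P : probability Omega R).
Local Notation vec := 'rV[R]_n.
Local Notation bvec := (borelType vec).
Variables (f : vec -> vec -> vec) (finv : vec * vec -> vec * vec).
Hypothesis fK : cancel (aug_model f) finv.
Hypothesis f_cont : continuous (aug_model f).
Hypothesis finv_cont : continuous finv.
Variables (U : {RV P >-> nat}) (S X X' : {RV P >-> bvec}).
Hypothesis X'E : forall w, X' w = f (X w) (S w).
Hypothesis supp : @full_support R d Omega P (vec * vec)%type (fun w => (X' w, X w)).
Hypothesis SX_indep : cond_independent U S X.
Variables (p : 'I_n -> nat -> R -> R) (post : nat -> vec * vec -> R).
Hypothesis p_ge0 : forall i l v, (1 <= l <= T)%N -> 0 <= p i l v.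
Hypothesis p_meas : forall i l, measurable_fun setT (p i l).
Hypothesis p_fin : forall i l, (1 <= l <= T)%N ->
  (\int[lebesgue_measure]_v (p i l v)%:E < +oo)%E.
Hypothesis S_density : cond_product_density T U S p.
Hypothesis post_gt0 : forall l z, (1 <= l <= T)%N -> 0 < post l z.
Hypothesis U_posterior : @is_posterior R d Omega P T _ (bvec * bvec)%type U
  (fun w => (X' w, X w)) post.
Variables (tau0 tau : nat).
Hypothesis tau0T : (1 <= tau0 <= T)%N.
Hypothesis tauT : (1 <= tau <= T)%N.
Variables (F : vec * vec -> R) (Phi : vec -> R) (G : 'I_n -> R -> R) (C : 'I_n -> R).
Hypothesis F_cont : continuous F.
Hypothesis G_cont : forall i, continuous (G i).
Hypothesis Phi_meas : measurable_fun setT (Phi : bvec -> R).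
Hypothesis post_ratio : forall z, post tau z = post tau0 z * expR (F z + Phi z.2).
Hypothesis p_ratio : forall i v, p i tau v = p i tau0 v * expR (G i v + C i).

Let ev (A B : set vec) : set Omega := [set w | A (S w) /\ B (X w)].
Let N l (A B : set vec) : set Omega := [set w | [/\ U w = l, A (S w) & B (X w)]].

Let U_meas l : measurable [set w | U w = l].
Proof. by rewrite -[X in measurable X]setTI; exact: (measurable_funP U _ [set l]). Qed.

Let S_meas (A : set bvec) : measurable A -> measurable [set w | A (S w)].
Proof. by move=> mA; rewrite -[X in measurable X]setTI; exact: (measurable_funP S _ A). Qed.

Let X_meas (A : set bvec) : measurable A -> measurable [set w | A (X w)].
Proof. by move=> mA; rewrite -[X in measurable X]setTI; exact: (measurable_funP X _ A). Qed.

Let ev_meas (A B : set bvec) : measurable A -> measurable B -> measurable (ev A B).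
Proof. by move=> mA mB; apply: measurableI; [exact: S_meas|exact: X_meas]. Qed.

Let N_meas l (A B : set bvec) : measurable A -> measurable B -> measurable (N l A B).
Proof.
move=> mA mB; rewrite [N _ _ _](_ : _ = [set w | U w = l] `&` ev A B).
  by apply: measurableI; [exact: U_meas|exact: ev_meas].
by apply/seteqP; split=> w; [case|case=> ? []].
Qed.

Let post_meas l : (1 <= l <= T)%N -> measurable_fun setT (fun w => post l (X' w, X w)).
Proof.
move=> hl; apply: (measurableT_comp (U_posterior hl).1).
by apply: measurable_fun_pair; exact: measurable_funP.
Qed.

Let finvE s x : finv (f x s, x) = (s, x).
Proof. by rewrite -[RHS]fK. Qed.

(** The innovation is recovered from [(X', X)] by [finv], so the event is one about the
    observations, to which the posterior applies. [A] is open to make its preimage under the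
    continuous [finv] measurable. *)
Let N_integral l (A B : set vec) : (1 <= l <= T)%N -> open A -> measurable (B : set bvec) ->
  P (N l A B) = (\int[P]_(w in ev A B) (post l (X' w, X w))%:E)%E.
Proof.
move=> hl oA mB.
pose D : set (bvec * bvec) := [set z | A (finv z).1] `&` (setT `*` B).
have mD : measurable D.
  apply: measurableI; last exact: measurableX.
  apply: open_prod_measurable.
  apply: (@open_comp _ _ (fun z => (finv z).1)) => // z _.
  by apply: continuous_comp; [exact: finv_cont|exact: cvg_fst].
have DE : (fun w => (X' w, X w)) @^-1` D = ev A B.
  by apply/seteqP; split => w; rewrite /D /= X'E finvE => -[] // ? [].
rewrite -DE -(U_posterior hl).2//; congr (P _); apply/seteqP; split => w.
  by case=> ? ? ?; split => //; rewrite X'E; split => //=; rewrite finvE.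
by case=> ? []; rewrite /= X'E finvE => ? [].
Qed.

Let ev_gt0 (A B : set vec) : open A -> open B -> A !=set0 -> B !=set0 -> (0 < P (ev A B))%E.
Proof.
move=> oA oB [s As] [x Bx].
pose O : set (vec * vec) := [set z | A (finv z).1 /\ B z.2].
have -> : ev A B = (fun w => (X' w, X w)) @^-1` O.
  by apply/seteqP; split => w; rewrite /O /= X'E finvE.
apply: supp; last by exists (f x s, x); rewrite /O/= finvE.
apply: openI.
  apply: (@open_comp _ _ (fun z => (finv z).1)) => // z _.
  by apply: continuous_comp; [exact: finv_cont|exact: cvg_fst].
by apply: (@open_comp _ _ snd) => // z _; exact: cvg_snd.
Qed.

Let N_gt0 l (A B : set vec) : (1 <= l <= T)%N -> open A -> measurable (B : set bvec) ->
  (0 < P (ev A B))%E -> (0 < P (N l A B))%E.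
Proof.
move=> hl oA mB ev0; rewrite N_integral//; apply: integral_pos_gt0 => //.
- exact: ev_meas (open_borel_measurable oA) mB.
- exact: post_meas.
- by move=> w; exact: post_gt0.
Qed.

Let prE (E : set Omega) : measurable E -> P E = (fine (P E))%:E.
Proof. by move=> mE; rewrite fineK// fin_num_measure. Qed.

(** On the event the ratio of the posteriors is [expR (f0 + phi0)] up to a factor [expR (eps *+ 2)]
    either way, and integration preserves this. *)
Let N_ratio (A B : set vec) (f0 phi0 eps : R) : open A -> measurable (B : set bvec) ->
  (forall s x, A s -> B x -> `|F (f x s, x) - f0| <= eps) ->
  (forall x, B x -> `|Phi x - phi0| <= eps) ->
  0 < fine (P (N tau0 A B)) -> 0 < fine (P (N tau A B)) ->
  `|ln (fine (P (N tau A B))) - ln (fine (P (N tau0 A B))) - (f0 + phi0)| <= eps *+ 2.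
Proof.
move=> oA mB hF hPhi n0 n1.
have mA := open_borel_measurable oA.
have mE := ev_meas mA mB.
have key w : ev A B w -> `|F (X' w, X w) + Phi (X w) - (f0 + phi0)| <= eps *+ 2.
  case=> Aw Bw; rewrite X'E; have := hF _ _ Aw Bw; have := hPhi _ Bw.
  rewrite !ler_norml => /andP[? ?] /andP[? ?]; apply/andP; split; lra.
apply: ln_ratio_bound => //; rewrite -lee_fin EFinM -!prE; try exact: N_meas.
- rewrite !N_integral//; apply: ge0_integral_le_scaled => //; try exact: post_meas.
  + by move=> w; exact/ltW/post_gt0.
  + by move=> w; exact/ltW/post_gt0.
  + move=> w /key; rewrite ler_norml => /andP[k1 k2].
    by rewrite post_ratio mulrC ler_pM2r ?post_gt0// ler_expR /=; lra.
- rewrite !N_integral//; apply: ge0_integral_le_scaled => //; try exact: post_meas.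
  + by move=> w; exact/ltW/post_gt0.
  + by move=> w; exact/ltW/post_gt0.
  + move=> w /key; rewrite ler_norml => /andP[k1 k2].
    rewrite post_ratio mulrCA ler_pMr ?post_gt0// -expRD -expR0 ler_expR /=; lra.
Qed.

Let J l i (A : set R) := fine (\int[lebesgue_measure]_(v in A) (p i l v)%:E)%E.

Let JE l i (A : set R) : (1 <= l <= T)%N -> measurable A ->
  (\int[lebesgue_measure]_(v in A) (p i l v)%:E)%E = (J l i A)%:E.
Proof.
move=> hl mA; rewrite fineK// ge0_fin_numE; last first.
  by apply: integral_ge0 => v _; rewrite lee_fin p_ge0.
apply: (le_lt_trans _ (p_fin i hl)); apply: ge0_subset_integral => //.
  by apply/measurable_EFinP; exact: p_meas.
by move=> v _; rewrite lee_fin p_ge0.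
Qed.

Let J_ge0 l i (A : set R) : (1 <= l <= T)%N -> 0 <= J l i A.
Proof.
by move=> hl; apply/fine_ge0/integral_ge0 => v _; rewrite lee_fin p_ge0.
Qed.

Let J_ratio i (A : set R) (g eps : R) : measurable A ->
  (forall v, A v -> `|G i v - g| <= eps) -> 0 < J tau0 i A -> 0 < J tau i A ->
  `|ln (J tau i A) - ln (J tau0 i A) - (g + C i)| <= eps.
Proof.
move=> mA hG j0 j1; apply: ln_ratio_bound => //; rewrite -lee_fin EFinM -!JE//.
- apply: ge0_integral_le_scaled => //; try exact: p_meas; try by move=> v; exact: p_ge0.
  + move=> v /hG; rewrite ler_norml => /andP[k1 k2].
    by rewrite p_ratio mulrC ler_wpM2r ?p_ge0// ler_expR; lra.
- apply: ge0_integral_le_scaled => //; try exact: p_meas; try by move=> v; exact: p_ge0.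
  + move=> v /hG; rewrite ler_norml => /andP[k1 k2].
    rewrite p_ratio mulrCA ler_peMr ?p_ge0// -expRD -expR0 ler_expR; lra.
Qed.

Let box (A : 'I_n -> set R) : set vec := [set s : vec | forall i, A i (s 0 i)].
Let UX l (B : set vec) : set Omega := [set w | U w = l /\ B (X w)].

(** Conditional independence splits off the past and the product density splits the box; the
    probability of class [l], assumed positive, cancels. *)
Let N_factor l A (B : set vec) : (1 <= l <= T)%N -> (forall i, measurable (A i)) ->
  measurable (box A : set bvec) -> measurable (B : set bvec) ->
  0 < fine (P [set w | U w = l]) ->
  fine (P (N l (box A) B)) = (\prod_i J l i (A i)) * fine (P (UX l B)).
Proof.
move=> hl mA mbA mB pi0; have := SX_indep l mbA mB.
have -> : P [set w | U w = l /\ box A (S w)] =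
    (fine (P [set w | U w = l]) * \prod_i J l i (A i))%:E.
  rewrite EFinM -prE; last exact: U_meas.
  rewrite (S_density hl mA); congr (_ * _)%E; rewrite -prodEFin.
  by apply: eq_bigr => i _; rewrite JE.
have mUX : measurable (UX l B) by apply: measurableI; [exact: U_meas|exact: X_meas].
rewrite (prE (N_meas l mbA mB)) (prE (U_meas l)) (prE mUX) -!EFinM => -[].
rewrite mulrC -mulrA; apply: mulfI; exact: lt0r_neq0.
Qed.

(** Bayes' rule on a box: the log-ratio obtained from the posteriors is equated with that of the
    factorised probabilities. The term subtracted last depends on [B] but not on the box. The factor
    [n.+2] counts one error for each [G i], one for [F] and one for [Phi]. *)
Let box_estimate A (B : set vec) (f0 phi0 eps : R) (g : 'I_n -> R) :
  (forall i, measurable (A i)) -> open (box A) -> measurable (B : set bvec) ->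
  (forall s x, box A s -> B x -> `|F (f x s, x) - f0| <= eps) ->
  (forall x, B x -> `|Phi x - phi0| <= eps) ->
  (forall i v, A i v -> `|G i v - g i| <= eps) ->
  (forall l, (1 <= l <= T)%N -> [/\ 0 < fine (P [set w | U w = l]),
     forall i, 0 < J l i (A i) & 0 < fine (P (UX l B))]) ->
  `|f0 - \sum_i g i - (ln (fine (P (UX tau B))) - ln (fine (P (UX tau0 B))) - phi0 + \sum_i C i)|
   <= eps *+ n.+2.
Proof.
move=> mA oA mB hF hPhi hG pos.
have mbA := open_borel_measurable oA.
have [pi0 J0 x0] := pos _ tau0T; have [pi1 J1 x1] := pos _ tauT.
have P0 l : (forall i, 0 < J l i (A i)) -> 0 < \prod_i J l i (A i) by move=> ?; apply: prodr_gt0.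
have := N_ratio oA mB hF hPhi.
rewrite !N_factor// => /(_ (mulr_gt0 (P0 _ J0) x0) (mulr_gt0 (P0 _ J1) x1)).
rewrite !lnM ?posrE ?P0// !ln_prod_ord//.
have : `|\sum_i ln (J tau i (A i)) - \sum_i ln (J tau0 i (A i)) - (\sum_i g i + \sum_i C i)| <= eps *+ n.
  rewrite -big_split/= -!sumrB (le_trans (ler_norm_sum _ _ _))//.
  rewrite -[leRHS](_ : \sum_(i < n) eps = _); last by rewrite sumr_const card_ord.
  by apply: ler_sum => i _; apply: J_ratio => //; exact: hG.
rewrite !mulrS mulr0n; move: (eps *+ n) => en.
rewrite !ler_norml => /andP[? ?] /andP[? ?]; apply/andP; split; lra.
Qed.

Let nbhd_estimate s x eps : 0 < eps -> \forall r \near 0^'+,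
  (forall s' x', ball s r s' -> ball x r x' -> `|F (f x' s', x') - F (f x s, x)| <= eps) /\
  (forall i v, ball (s 0 i) r v -> `|G i v - G i (s 0 i)| <= eps).
Proof.
move=> eps0.
have H1 : \forall r \near 0^'+, forall s' x', ball s r s' -> ball x r x' ->
    `|F (f x' s', x') - F (f x s, x)| <= eps.
  have cF : {for (s, x), continuous (F \o aug_model f)}.
    by apply: continuous_comp; [exact: f_cont|exact: F_cont].
  move/cvgrPdist_le : cF => /(_ _ eps0) /nbhs_ballP[e /= e0 He].
  near=> r; move=> s' x' hs hx; rewrite distrC.
  have re : r <= e by near: r; exact: nbhs_right_le.
  by apply: (He (s', x')); split; [exact: le_ball re _ hs|exact: le_ball re _ hx].
have H2 i : \forall r \near 0^'+, forall v, ball (s 0 i) r v -> `|G i v - G i (s 0 i)| <= eps.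
  have /cvgrPdist_le/(_ _ eps0)/nbhs_ballP[e /= e0 He] := @G_cont i (s 0 i).
  near=> r; move=> v hv; rewrite distrC; apply: He; apply: le_ball hv.
  by near: r; exact: nbhs_right_le.
by have := filter_forall (at_right_proper_filter (0 : R)) H2; apply: filterS2 H1 => r.
Unshelve. all: by end_near. Qed.

(* [Phi] is only measurable: instead of shrinking a neighbourhood, restrict to a
   level slice of positive probability. *)
Let level_slice (A B : set vec) (eps : R) : 0 < eps -> open A -> measurable (B : set bvec) ->
  (0 < P (ev A B))%E ->
  exists (B' : set bvec) (phi0 : R), [/\ measurable B', B' `<=` B, (0 < P (ev A B'))%E &
    forall x, B' x -> `|Phi x - phi0| <= eps].
Proof.
move=> eps0 oA mB ev0.
pose Bm (m : int) : set bvec := B `&` Phi @^-1` `[m%:~R * eps, (m + 1)%:~R * eps[.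
have mBm m : measurable (Bm m).
  by apply: measurableI => //; rewrite -[X in measurable X]setTI; exact: Phi_meas.
have mA := open_borel_measurable oA.
have [m m0] : exists m, (0 < P (ev A (Bm m)))%E.
  apply: contrapT => /forallNP H.
  have H0 m : P (ev A (Bm m)) = 0%E.
    by apply/eqP; rewrite eq_le measure_ge0 andbT leNgt; exact/negP/H.
  (* The integers are enumerated by [unpickle]; a code of no integer falls back on slice 0, which is
     null too. *)
  pose E k := ev A (Bm (odflt 0 (unpickle k))).
  have nE : P.-negligible (\bigcup_k E k).
    by apply: negligible_bigcup => k; exists (E k); split => //; [exact: ev_meas|exact: H0].
  have UE : \bigcup_k E k = ev A B.
    apply/seteqP; split => [w [k _ [Aw [Bw _]]]//|w [Aw Bw]].
    exists (pickle (Num.floor (Phi (X w) / eps))) => //; rewrite /E pickleK /=.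
    split => //; split => //=; rewrite in_itv/= -ler_pdivlMr// -ltr_pdivrMr//.
    by rewrite floor_le floorD1_gt.
  move: nE; rewrite UE => /(negligibleP P (ev_meas mA mB)) E0.
  by move: ev0; rewrite E0 ltxx.
exists (Bm m), (m%:~R * eps); split => //; first by move=> x [].
move=> x [_] /=; rewrite in_itv/= intrD mulrDl mul1r => /andP[h1 h2].
by rewrite ler_norml; apply/andP; split; lra.
Qed.

(** Probabilities of small boxes around [s0] and [s1] stand in for pointwise densities. Both
    estimates use the same set [B'] of pasts, so the term depending on the classes and the past
    cancels in their difference. *)
Lemma posterior_ratio_separation s0 s1 x :
  F (f x s0, x) - F (f x s1, x) = \sum_i (G i (s0 0 i) - G i (s1 0 i)).
Proof.
apply/eqP; rewrite -subr_eq0 -normr_le0; apply/ler_addgt0Pr => e e0; rewrite add0r.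
pose eps := e / (2 * n.+2%:R).
have eps0 : 0 < eps by rewrite divr_gt0// mulr_gt0.
have epsE : eps *+ n.+2 = e / 2.
  by rewrite -mulr_natr /eps invfM mulrA mulfVK// pnatr_eq0.
have [r [[r0 [F0 G0]] [F1 G1]]] : exists r : R, (0 < r /\
    ((forall s' x', ball s0 r s' -> ball x r x' -> `|F (f x' s', x') - F (f x s0, x)| <= eps) /\
     (forall i v, ball (s0 0 i) r v -> `|G i v - G i (s0 0 i)| <= eps))) /\
    ((forall s' x', ball s1 r s' -> ball x r x' -> `|F (f x' s', x') - F (f x s1, x)| <= eps) /\
     (forall i v, ball (s1 0 i) r v -> `|G i v - G i (s1 0 i)| <= eps)).
  apply: (@filter_ex _ (0 : R)^'+); apply: filterI; last exact: nbhd_estimate.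
  by apply: filterI; [exact: nbhs_right_gt|exact: nbhd_estimate].
pose A (s : vec) i : set R := ball (s 0 i) r.
have boxE s : box (A s) = ball s r.
  apply/seteqP; split => t; last by case=> _ H i; exact: H.
  by move=> H; split => // i j; rewrite ord1; exact: H.
have oA s : open (box (A s)) by rewrite boxE; exact: ball_open.
have mA s i : measurable (A s i) by apply: open_measurable; exact: ball_open.
have oB : open (ball x r) by exact: ball_open.
have mB := open_borel_measurable oB.
have evB s : (0 < P (ev (box (A s)) (ball x r)))%E.
  apply: ev_gt0 => //; first by exists s; rewrite boxE; exact: ballxx.
  by exists x; exact: ballxx.
(* The slice is chosen for the box at [s0] only. For [s1] the factors [J] are positive through the
   whole ball of pasts, and [UX l B'] has positive probability by the choice at [s0]. *)
have [B' [phi0 [mB' BB' evB' hPhi]]] := level_slice eps0 (oA s0) mB (evB s0).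
have pos s l : (1 <= l <= T)%N -> [/\ 0 < fine (P [set w | U w = l]),
     forall i, 0 < J l i (A s i) & 0 < fine (P (UX l B'))].
  move=> hl; have mAs t := open_borel_measurable (oA t).
  have pi0 : 0 < fine (P [set w | U w = l]).
    rewrite -lte_fin -prE//; apply: lt_le_trans (N_gt0 hl (oA s0) mB' evB') _.
    by apply: le_measure; rewrite ?inE; [exact: N_meas|exact: U_meas|move=> w []].
  have K t (D : set bvec) : measurable D -> (0 < P (ev (box (A t)) D))%E ->
      (forall i, 0 < J l i (A t i)) /\ 0 < fine (P (UX l D)).
    move=> mD /(N_gt0 hl (oA t) mD); rewrite prE; last exact: N_meas.
    rewrite lte_fin N_factor// => K.
    have X0 : 0 <= fine (P (UX l D)) by exact: fine_ge0.
    split=> [i|]; rewrite lt0r ?J_ge0 ?X0 ?andbT//; apply/eqP => Z.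
      by move: K; rewrite (bigD1 i)//= Z !mul0r ltxx.
    by move: K; rewrite Z mulr0 ltxx.
  split=> //; first by have [] := K s _ mB (evB s).
  by have [] := K s0 _ mB' evB'.
have E0 : `|F (f x s0, x) - \sum_i G i (s0 0 i) -
    (ln (fine (P (UX tau B'))) - ln (fine (P (UX tau0 B'))) - phi0 + \sum_i C i)| <= eps *+ n.+2.
  apply: (box_estimate (A := A s0)) => // [s' x' hs hx|]; last exact: pos.
  by apply: F0; [rewrite -boxE|exact: BB'].
have E1 : `|F (f x s1, x) - \sum_i G i (s1 0 i) -
    (ln (fine (P (UX tau B'))) - ln (fine (P (UX tau0 B'))) - phi0 + \sum_i C i)| <= eps *+ n.+2.
  apply: (box_estimate (A := A s1)) => // [s' x' hs hx|]; last exact: pos.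
  by apply: F1; [rewrite -boxE|exact: BB'].
rewrite sumrB; move: E0 E1; rewrite epsE !ler_norml => /andP[? ?] /andP[? ?].
by apply/andP; split; lra.
Qed.

End PosteriorRatio.

(** * Regularity and class ratios of the model densities and of the softmax *)

Lemma continuous_sum (R : realType) (V : topologicalType) (I : Type) (r : seq I) (F : I -> V -> R) :
  (forall i, continuous (F i)) -> continuous (fun x => \sum_(i <- r) F i x).
Proof.
move=> cF; apply: (@continuous_big _ _ +%R) => [|i _]; last exact: cF.
exact: add_continuous.
Qed.

Lemma twice_derivable_continuous (R : realType) (a : R -> R) : twice_derivable a -> continuous a.
Proof. by case=> da _ v; apply/differentiable_continuous/derivable1_diffP/da. Qed.

Lemma C1_continuous (R : realType) (V W : normedModType R) (F : V -> W) : C1 F -> continuous F.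
Proof. by case=> dF _ p; exact/differentiable_continuous. Qed.

Section ExponentialFamilyDensity.
Variables (R : realType) (T k : nat) (Q : R -> R) (Z : nat -> R) (q : 'I_k -> R -> R)
  (lam : 'I_k -> nat -> R).
Hypothesis Q_ge0 : forall v, 0 <= Q v.
Hypothesis Q_meas : measurable_fun setT Q.
Hypothesis ZE : normalizing_constant T Q Z q lam.
Hypothesis q_der : forall j, twice_derivable (q j).

Let weight_meas l : measurable_fun setT (expfam_weight Q q lam l).
Proof.
apply: measurable_funM => //; apply: measurableT_comp => //.
apply: measurable_sum => j; apply: measurable_funM; last exact: measurable_cst.
by apply: continuous_measurable_fun; apply: twice_derivable_continuous; exact: q_der.
Qed.

Let densityE l v : expfam_density Q Z q lam l v = (Z l)^-1 * expfam_weight Q q lam l v.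
Proof. by rewrite /expfam_density /expfam_weight mulrA [_ / _]mulrC. Qed.

Lemma expfam_density_measurable l : measurable_fun setT (expfam_density Q Z q lam l).
Proof.
rewrite (funext (densityE l)).
by apply: measurable_funM => //; exact: measurable_cst.
Qed.

Lemma expfam_density_ge0 l v : (1 <= l <= T)%N -> 0 <= expfam_density Q Z q lam l v.
Proof.
move=> /ZE[/ltW Zl _]; apply: mulr_ge0; last exact: expR_ge0.
by rewrite divr_ge0.
Qed.

Lemma expfam_density_integral_fin l : (1 <= l <= T)%N ->
  (\int[lebesgue_measure]_v (expfam_density Q Z q lam l v)%:E < +oo)%E.
Proof.
move=> hl; have [Zl IZ] := ZE hl.
apply: (@le_lt_trans _ _
  ((Z l)^-1%:E * \int[lebesgue_measure]_v (expfam_weight Q q lam l v)%:E)%E).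
  apply: ge0_integral_le_scaled => // [||v|v||v _].
  - exact: expfam_density_measurable.
  - exact: weight_meas.
  - exact: expfam_density_ge0.
  - by apply: mulr_ge0; rewrite ?expR_ge0.
  - by rewrite invr_ge0 ltW.
  - by rewrite densityE.
by rewrite IZ -EFinM ltry.
Qed.

(** Stated as a product because [Q] may vanish; the ratio of the normalizing constants goes into the
    exponent. *)
Lemma expfam_density_ratio l l' v : (1 <= l <= T)%N -> (1 <= l' <= T)%N ->
  expfam_density Q Z q lam l v = expfam_density Q Z q lam l' v *
    expR (\sum_j q j v * (lam j l - lam j l') + (ln (Z l') - ln (Z l))).
Proof.
move=> /ZE[Zl _] /ZE[Zl' _]; rewrite /expfam_density.
have -> : \sum_j q j v * (lam j l - lam j l') =
    \sum_j q j v * lam j l - \sum_j q j v * lam j l'.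
  by rewrite -sumrB; apply: eq_bigr => j _; rewrite mulrBr.
rewrite expRD [expR (_ - _)]expRB [expR (ln _ - _)]expRB !lnK ?posrE//.
have := expR_gt0 (\sum_j q j v * lam j l') => /lt0r_neq0 ?.
by have := lt0r_neq0 Zl; have := lt0r_neq0 Zl' => ? ?; field; apply/and3P.
Qed.

End ExponentialFamilyDensity.

Lemma softmax_gt0 (R : realType) (n k T : nat) (z : 'I_n -> 'I_k -> nat -> 'rV[R]_n * 'rV[R]_n -> R) l p :
  (1 <= l <= T)%N -> 0 < softmax T z l p.
Proof.
move=> /andP[l1 lT]; rewrite divr_gt0 ?expR_gt0//.
by rewrite big_ltn ?ltnS ?(leq_trans l1)// ltr_pwDl ?expR_gt0// sumr_ge0.
Qed.

Lemma softmax_ratio (R : realType) (n k T : nat) (z : 'I_n -> 'I_k -> nat -> 'rV[R]_n * 'rV[R]_n -> R)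
    l l' p :
  softmax T z l p = softmax T z l' p * expR (\sum_i \sum_j (z i j l p - z i j l' p)).
Proof.
rewrite /softmax mulrAC -expRD; congr (expR _ / _).
rewrite -big_split/=; apply: eq_bigr => i _; rewrite -big_split/=.
by apply: eq_bigr => j _; rewrite addrC subrK.
Qed.

(** * Identification of the innovations in the NVAR model *)

Theorem theorem2 (R : realType) (n k T : nat)
  (hn : (1 <= n)%N) (hk : (2 <= k)%N)
  (d : measure_display) (Omega : measurableType d) (P : probability Omega R)
  (* NVAR model *)
  (f : 'rV[R]_n -> 'rV[R]_n -> 'rV[R]_n)
  (ftilde_inv : 'rV[R]_n * 'rV[R]_n -> 'rV[R]_n * 'rV[R]_n)
  (hfK : cancel (aug_model f) ftilde_inv)
  (hfVK : cancel ftilde_inv (aug_model f))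
  (hf_smooth : C1 (aug_model f)) (hfV_smooth : C1 ftilde_inv)
  (x s : nat -> {RV P >-> borelType 'rV[R]_n}) (u : nat -> {RV P >-> nat})
  (hx : forall (t : nat) (w : Omega), x t.+1 w = f (x t w) (s t.+1 w))
  (* auxiliary variable *)
  (hu : forall (t : nat) (w : Omega), (1 <= u t.+1 w <= T)%N)
  (* innovations *)
  (Q : 'I_n -> R -> R) (Z : 'I_n -> nat -> R)
  (q : 'I_n -> 'I_k -> R -> R) (lam : 'I_n -> 'I_k -> nat -> R)
  (hQ0 : forall i v, 0 <= Q i v) (hQm : forall i, measurable_fun setT (Q i))
  (hZ : forall i, normalizing_constant T (Q i) (Z i) (q i) (lam i))
  (hq : forall i j, twice_derivable (q i j))
  (hmin : forall i,
    minimal_order T k (expfam_density (Q i) (Z i) (q i) (lam i)))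
  (hstrong : forall i, strongly_exponential T (q i) (lam i))
  (hs : forall t : nat, cond_product_density T (u t.+1) (s t.+1)
     (fun i => expfam_density (Q i) (Z i) (q i) (lam i)))
  (htemp : mutually_independent (fun t => s t.+1))
  (hpast : forall t : nat, cond_independent (u t.+1) (s t.+1) (x t))
  (* modulation matrix *)
  (hL : \rank (modulation_matrix T lam) = (n * k)%N)
  (* multinomial logistic regression *)
  (w : 'I_n -> 'I_k -> nat -> R) (psi : 'I_n -> 'I_k -> R -> R)
  (h : 'rV[R]_n -> 'rV[R]_n -> 'rV[R]_n)
  (phi : 'rV[R]_n -> nat -> R) (b : nat -> R)
  (hh_cont : continuous (fun p : 'rV[R]_n * 'rV[R]_n => h p.1 p.2))
  (hh : bijective (aug_feature h))
  (hpsi : forall i j, twice_derivable (psi i j))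
  (hpsi_indep : forall (i : 'I_n) (theta : 'I_k -> R),
    (exists c : R, forall y : R, \sum_(j < k) psi i j y * theta j = c) ->
    forall j, theta j = 0)
  (* infinite-data limit at a time point: the model is the true posterior *)
  (t : nat)
  (hsupp : @full_support R d Omega P ('rV[R]_n * 'rV[R]_n)%type
     (fun omega => (x t.+1 omega, x t omega)))
  (hpost : @is_posterior R d Omega P T _
     (borelType 'rV[R]_n * borelType 'rV[R]_n)%type (u t.+1)
     (fun omega => (x t.+1 omega, x t omega))
     (softmax T (logit w psi h phi b))) :
  exists (sigma : 'S_n) (c : 'I_n -> R -> R),
    (forall i, bijective (c i)) /\
    forall (xt xprev : 'rV[R]_n) (i : 'I_n),
      h xt xprev 0 i = c i ((ftilde_inv (xt, xprev)).1 0 (sigma i)).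
Proof.
pose g s x := h (f x s) x.
have f_cont := C1_continuous hf_smooth.
have g_cont : continuous (fun p : 'rV[R]_n * 'rV[R]_n => g p.1 p.2).
  move=> p; apply: (@continuous_comp _ _ _ (aug_model f) (fun p => h p.1 p.2)).
    exact: f_cont.
  exact: hh_cont.
have coord_cont i : continuous (fun p : 'rV[R]_n * 'rV[R]_n => h p.1 p.2 0 i).
  move=> p; apply: (@continuous_comp _ _ _ (fun p => h p.1 p.2) (fun M : 'rV[R]_n => M 0 i)).
    exact: hh_cont.
  exact: coord_continuous.
have [hinv hK hVK] := hh.
(* Both augmented maps keep the past, so for a fixed past their bijectivity passes to [g]. *)
have g_inj y : injective (g ^~ y).
  move=> s1 s2 E.
  have : aug_feature h (aug_model f (s1, y)) = aug_feature h (aug_model f (s2, y)).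
    by rewrite /aug_feature/=; congr pair.
  by move=> /(can_inj hK)/(can_inj hfK)[].
have g_surj y z : exists s', g s' y = z.
  have := hVK (z, y); case: (hinv (z, y)) => a c [E cy]; rewrite /= in E cy.
  have := hfVK (a, c); case: (ftilde_inv (a, c)) => s1 x1 [F1 F2]; rewrite /= in F1 F2.
  by exists s1; rewrite /g -cy -[X in f X _]F2 F1.
have q_indep i theta c0 : (forall v, \sum_(j < k) q i j v * theta j = c0) ->
    forall j, theta j = 0.
  apply: (minimal_order_affine_indep (hQ0 i) _ (hmin i)).
  by move=> tau /(hZ i)[].
have rel tau : (2 <= tau <= T)%N -> forall s1 s2 y : 'rV[R]_n,
  \sum_i \sum_j (psi i j (g s1 y 0 i) - psi i j (g s2 y 0 i)) * (w i j tau - w i j 1%N) =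
  \sum_i \sum_j (q i j (s1 0 i) - q i j (s2 0 i)) * (lam i j tau - lam i j 1%N).
  move=> /andP[tau2 tauT] s1 s2 y.
  have hT1 : (1 <= 1 <= T)%N by rewrite (leq_trans _ tauT)// ltnW.
  have hT2 : (1 <= tau <= T)%N by rewrite tauT ltnW.
  (* [F] collects the part of the logit difference seen through [h]. [phi] and [b] enter every
     [z i j], so [Phi] counts them once for each pair. *)
  pose F (z : 'rV[R]_n * 'rV[R]_n) := \sum_i \sum_j psi i j (h z.1 z.2 0 i) * (w i j tau - w i j 1%N).
  pose Phi y := \sum_(i < n) \sum_(j < k) (phi y tau - phi y 1%N + (b tau - b 1%N)).
  pose G i v := \sum_j q i j v * (lam i j tau - lam i j 1%N).
  have ratio z : softmax T (logit w psi h phi b) tau z =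
      softmax T (logit w psi h phi b) 1%N z * expR (F z + Phi z.2).
    rewrite (softmax_ratio _ _ tau 1%N); congr (_ * expR _).
    rewrite -big_split/=; apply: eq_bigr => i _; rewrite -big_split/=.
    by apply: eq_bigr => j _; rewrite /logit; ring.
  have F_cont : continuous F.
    apply: continuous_sum => i; apply: continuous_sum => j z; apply: cvgMr_tmp.
    apply: (@continuous_comp _ _ _ (fun p => h p.1 p.2 0 i) (psi i j)); first exact: coord_cont.
    exact: twice_derivable_continuous.
  have Phi_meas : measurable_fun setT (Phi : borelType 'rV[R]_n -> R).
    (* [Phi] is the log-ratio of two measurable posteriors minus the continuous [F]. The first
       component 0 is arbitrary, since [Phi] depends on the past alone. *)
    have -> : Phi = (fun y => ln (softmax T (logit w psi h phi b) tau (0, y)) -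
        ln (softmax T (logit w psi h phi b) 1%N (0, y)) - F (0, y)).
      apply/funext => z; rewrite ratio lnM ?posrE ?softmax_gt0 ?expR_gt0// expRK /=.
      by ring.
    apply: measurable_funB; first apply: measurable_funB.
    - apply: measurableT_comp; first exact: measurable_ln.
      exact: (@section_measurable R n (softmax T (logit w psi h phi b) tau) 0 (hpost _ hT2).1).
    - apply: measurableT_comp; first exact: measurable_ln.
      exact: (@section_measurable R n (softmax T (logit w psi h phi b) 1%N) 0 (hpost _ hT1).1).
    - apply: continuous_borel_measurable => z.
      by apply: (@continuous2_cvg _ 'rV[R]_n 'rV[R]_n R (nbhs z) _ (cst 0) id
        (fun y y' => F (y, y')) 0 z (F_cont (0, z))); [exact: cvg_cst|exact: cvg_id].
  pose p i := expfam_density (Q i) (Z i) (q i) (lam i).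
  have p_ge0 i l v : (1 <= l <= T)%N -> 0 <= p i l v by exact: expfam_density_ge0.
  have p_meas i l : measurable_fun setT (p i l) by exact: expfam_density_measurable.
  have p_fin i l : (1 <= l <= T)%N -> (\int[lebesgue_measure]_v (p i l v)%:E < +oo)%E.
    exact: expfam_density_integral_fin.
  have post_gt0 l z : (1 <= l <= T)%N -> 0 < softmax T (logit w psi h phi b) l z.
    exact: softmax_gt0.
  have G_cont i : continuous (G i).
    apply: continuous_sum => j v; apply: cvgMr_tmp.
    exact: twice_derivable_continuous.
  have p_ratio i v : p i tau v = p i 1%N v * expR (G i v + (ln (Z i 1%N) - ln (Z i tau))).
    exact: expfam_density_ratio.
  have := posterior_ratio_separation hfK f_cont (C1_continuous hfV_smooth) (hx t) hsupp
    (hpast t) p_ge0 p_meas p_fin (hs t) post_gt0 hpost hT1 hT2 F_cont G_cont Phi_meas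
    ratio p_ratio s1 s2 y.
  have -> : F (f y s1, y) - F (f y s2, y) =
      \sum_i \sum_j (psi i j (g s1 y 0 i) - psi i j (g s2 y 0 i)) * (w i j tau - w i j 1%N).
    rewrite /F -sumrB; apply: eq_bigr => i _; rewrite -sumrB; apply: eq_bigr => j _.
    by rewrite mulrBl.
  move=> ->.
  apply: eq_bigr => i _; rewrite /G -sumrB; apply: eq_bigr => j _.
  by rewrite mulrBl.
have [alpha Halpha] := statistics_separation q_indep hL rel.
have [] := @componentwise_separation R n k psi q g
  (fun l j i v => \sum_j' alpha l j i j' * q i j' v) hk g_cont g_inj g_surj.
- move=> l j i v.
  rewrite (_ : (fun v => \sum_j' alpha l j i j' * q i j' v) = \sum_j' (alpha l j i j' \*: q i j')).
    by apply: derivable_sum => j'; apply: derivableZ; exact: (hq i j').1.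
  by apply/funext => r; rewrite fct_sumE.
- move=> l j s1 s2 y; rewrite Halpha; apply: eq_bigr => i _.
  by rewrite sumrB.
- exact: hpsi_indep.
- exact: statistics_determined hL rel.
- move=> i; have H := strongly_exponential_nonconst hL (ltnW hk) (@hstrong i); exact: H.
move=> sigma [c [c_bij gc]]; exists sigma, c; split => // xt xprev i.
(* The innovation recovered from [(xt, xprev)] satisfies [f xprev s1 = xt], which turns the
   statement on [g] into one on [h]. *)
have := hfVK (xt, xprev); case: (ftilde_inv (xt, xprev)) => s1 x1 [/= F1 F2].
by rewrite -(gc s1 xprev) /g -[X in f X _]F2 F1.
Qed.
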